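(* Let $\mathscr{A}$ be an abelian arrangement of rank $r$ in $T\cong G^\ell$. Then $L(\mathscr{A})$ is supersolvable (resp. strictly supersolvable) if and only if there is a chain $\varnothing=\mathscr{A}_0\subseteq\mathscr{A}_1\subseteq\cdots\subseteq\mathscr{A}_r=\mathscr{A}$ of subarrangements such that each $\mathscr{A}_i$ is an M-ideal (resp. a TM-ideal) of $\mathscr{A}_{i+1}$ in the arrangement sense.
   Context: Setting: $G\cong(\mathbb{S}^1)^a\times\mathbb{R}^b$, $g=a+b$, $\Gamma\cong\mathbb{Z}^\ell$, $T=\operatorname{Hom}(\Gamma,G)$, $H_{\alpha,c}=\{\varphi\in T:\varphi(\alpha)=c\}$; an abelian arrangement is the set of connected components of $H_{\alpha,c}$ for $(\alpha,c)$ in a finite subset of $(\Gamma\setminus\{0\})\times G$. $L(\mathscr{A})$: connected components of nonempty intersections of subsets of $\mathscr{A}$ (empty intersection $=T$), ordered by reverse inclusion, rank $\operatorname{codim}/g$; the rank of $\mathscr{A}$ is the maximal rank in $L(\mathscr{A})$. For a subarrangement $\mathscr{B}\subseteq\mathscr{A}$, $L(\mathscr{B})\subseteq L(\mathscr{A})$. Arrangement sense: $\mathscr{B}$ is an M-ideal of $\mathscr{A}$ if $L(\mathscr{B})$ is a proper order ideal of $L(\mathscr{A})$ and for any two distinct $H_1,H_2\in\mathscr{A}\setminus\mathscr{B}$ and every connected component $C$ of $H_1\cap H_2$ there is $H_3\in\mathscr{B}$ with $C\subseteq H_3$; it is a TM-ideal if moreover $X\cap H$ is connected for every $X\in L(\mathscr{B})$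 and $H\in\mathscr{A}\setminus\mathscr{B}$. Poset sense: posets are finite, with minimum $\hat0$, ranked; $\bigvee T$ is the set of minimal upper bounds; a lattice is geometric if $y$ covers $x$ iff $y=x\vee a$ for an atom $a\not\le x$; locally geometric means every $\mathcal{P}_{\le x}$ is a geometric lattice; $x$ in a geometric lattice $L$ is modular if $x\wedge(y\vee z)=(x\wedge y)\vee z$ for all $z\le x$, $y\in L$. An M-ideal of a locally geometric $\mathcal{P}$ is a pure (all maximal elements of equal rank), join-closed ($T\subseteq\mathcal{Q}\Rightarrow\bigvee T\subseteq\mathcal{Q}$) order ideal $\mathcal{Q}$ with (1) $|a\vee y|\ge1$ for $y\in\mathcal{Q}$, $a\in A(\mathcal{P})\setminus A(\mathcal{Q})$ ($A$ = set of atoms) and (2) for each maximal $x\in\mathcal{P}$ some maximal $y\in\mathcal{Q}$ is modular in $\mathcal{P}_{\le x}$; a TM-ideal replaces (1) by $|a\vee y|=1$. $\mathcal{P}$ is supersolvable (resp. strictly supersolvable) if there is a chain $\{\hat0\}=\mathcal{Q}_0\subsetneq\cdots\subsetneq\mathcal{Q}_r=\mathcal{P}$ with each $\mathcal{Q}_i$ an M-ideal (resp. TM-ideal) of $\mathcal{Q}_{i+1}$ and $\operatorname{rk}(\mathcal{Q}_i)=i$. *)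

(* Defs.v *)
From HB Require Import structures.
From mathcomp Require Import all_boot all_algebra.
From mathcomp Require Import all_classical all_reals all_analysis.
From mathcomp Require Import complex.

Set Implicit Arguments.
Unset Strict Implicit.
Unset Printing Implicit Defensive.

Import GRing.Theory Num.Theory numFieldTopology.Exports numFieldNormedType.Exports.
Local Open Scope ring_scope.
Local Open Scope classical_set_scope.

(* A poset is a set P : set X ordered by le; subposets carry the induced    *)
(* order.                                                                   *)

Definition plt (X : Type) (le : X -> X -> Prop) (x y : X) : Prop :=
  le x y /\ x <> y.

Definition is_bottom (X : Type) (le : X -> X -> Prop) (P : set X) (z : X) :=
  P z /\ forall x, P x -> le z x.

Definition covers (X : Type) (le : X -> X -> Prop) (P : set X) (x y : X) :=
  [/\ P x, P y, plt le x y & ~ exists z, [/\ P z, plt le x z & plt le z y]].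

Fixpoint is_chain (X : Type) (le : X -> X -> Prop) (P : set X) (x : X)
    (s : seq X) : Prop :=
  match s with
  | [::] => True
  | y :: s' => [/\ P y, plt le x y & is_chain le P y s']
  end.

Definition height (X : Type) (le : X -> X -> Prop) (P : set X) (n : nat) :=
  (exists x0 s, [/\ P x0, is_chain le P x0 s & size s = n]) /\
  (forall x0 s, P x0 -> is_chain le P x0 s -> (size s <= n)%N).

Definition below (X : Type) (le : X -> X -> Prop) (P : set X) (x : X) :=
  [set y | P y /\ le y x].

(* rank of an element x of a ranked poset P with minimum: length of the
   (longest, equivalently any) maximal chain from the minimum to x *)
Definition rank_of (X : Type) (le : X -> X -> Prop) (P : set X) (x : X)
    (n : nat) := height le (below le P x) n.

Definition is_maximal (X : Type) (le : X -> X -> Prop) (P : set X) (x : X) :=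
  P x /\ ~ exists y, P y /\ plt le x y.

Definition order_ideal (X : Type) (le : X -> X -> Prop) (P Q : set X) :=
  Q `<=` P /\ forall x y, Q y -> P x -> le x y -> Q x.

Definition pure (X : Type) (le : X -> X -> Prop) (P Q : set X) :=
  forall x y n m, is_maximal le Q x -> is_maximal le Q y ->
    rank_of le P x n -> rank_of le P y m -> n = m.

Definition upper_bounds (X : Type) (le : X -> X -> Prop) (P T : set X) :=
  [set y | P y /\ forall t, T t -> le t y].

Definition joins (X : Type) (le : X -> X -> Prop) (P T : set X) :=
  [set y | upper_bounds le P T y /\
           forall z, upper_bounds le P T z -> le z y -> z = y].

Definition join_closed (X : Type) (le : X -> X -> Prop) (P Q : set X) :=
  forall T, T `<=` Q -> joins le P T `<=` Q.

Definition atoms (X : Type) (le : X -> X -> Prop) (P : set X) :=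
  [set a | exists z, is_bottom le P z /\ covers le P z a].

Definition is_lub (X : Type) (le : X -> X -> Prop) (L : set X) (x y j : X) :=
  [/\ L j, le x j, le y j & forall z, L z -> le x z -> le y z -> le j z].

Definition is_glb (X : Type) (le : X -> X -> Prop) (L : set X) (x y m : X) :=
  [/\ L m, le m x, le m y & forall z, L z -> le z x -> le z y -> le z m].

Definition is_lattice (X : Type) (le : X -> X -> Prop) (L : set X) :=
  (exists z, is_bottom le L z) /\
  forall x y, L x -> L y ->
    (exists j, is_lub le L x y j) /\ (exists m, is_glb le L x y m).

Definition geometric (X : Type) (le : X -> X -> Prop) (L : set X) :=
  is_lattice le L /\
  forall x y, L x -> L y ->
    (covers le L x y <->
     exists a, [/\ atoms le L a, ~ le a x & is_lub le L x a y]).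

Definition loc_geometric (X : Type) (le : X -> X -> Prop) (P : set X) :=
  forall x, P x -> geometric le (below le P x).

Definition modular_in (X : Type) (le : X -> X -> Prop) (L : set X) (y : X) :=
  L y /\
  forall z w j1 m1 m2 j2, L z -> le z y -> L w ->
    is_lub le L w z j1 -> is_glb le L y j1 m1 ->
    is_glb le L y w m2 -> is_lub le L m2 z j2 -> m1 = j2.

Definition poset_Mideal (strict : bool) (X : Type) (le : X -> X -> Prop)
    (P Q : set X) :=
  [/\ loc_geometric le P, order_ideal le P Q, pure le P Q /\
      join_closed le P Q,
      (forall y a, Q y -> atoms le P a -> ~ atoms le Q a ->
         if strict then exists z, joins le P ([set a] `|` [set y]) = [set z]
         else joins le P ([set a] `|` [set y]) !=set0) &
      (forall x, is_maximal le P x ->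
         exists y, is_maximal le Q y /\ modular_in le (below le P x) y)].

Definition poset_supersolvable (strict : bool) (X : Type)
    (le : X -> X -> Prop) (P : set X) :=
  exists (r : nat) (Q : nat -> set X),
  [/\ exists z, is_bottom le P z /\ Q 0%N = [set z],
      Q r = P,
      (forall i, (i < r)%N ->
         [/\ Q i `<=` Q i.+1, Q i <> Q i.+1 & poset_Mideal strict le (Q i.+1) (Q i)]) &
      (forall i, (i <= r)%N -> height le (Q i) i)].

(* G = (S^1)^a x R^b, Gamma = Z^l, T = Hom(Gamma, G) = G^l (a homomorphism  *)
(* is determined by the images of the standard basis vectors).              *)
(* A point of T is encoded as a triple (X, Y, Z) of real matrices, where    *)
(* (X i j, Y i j) is the j-th circle coordinate of phi(e_i) (a point of the *)
(* unit circle in R^2) and Z i k is its k-th real coordinate.  The ambient  *)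
(* space carries the Euclidean (product) topology, and T the subspace one.  *)

Definition amb (R : realType) (l a b : nat) :=
  ('M[R]_(l, a) * 'M[R]_(l, a) * 'M[R]_(l, b))%type.

Definition torusT (R : realType) (l a b : nat) : set (amb R l a b) :=
  [set p : amb R l a b | forall (i : 'I_l) (j : 'I_a), (p.1.1 i j) ^+ 2 + (p.1.2 i j) ^+ 2 = 1].

(* an element c of G: circle coordinates (c.1.1 j, c.1.2 j), real ones c.2 k *)
Definition Gelt (R : realType) (a b : nat) :=
  (('I_a -> R) * ('I_a -> R) * ('I_b -> R))%type.

Definition in_G (R : realType) (a b : nat) (c : Gelt R a b) :=
  forall j, (c.1.1 j) ^+ 2 + (c.1.2 j) ^+ 2 = 1.

(* H_{alpha,c} = { phi in T | phi(alpha) = c }, the group G being written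
   multiplicatively (as complex numbers of modulus 1) on the circle factors
   and additively on the real factors. *)
Definition Hset (R : realType) (l a b : nat) (alpha : 'I_l -> int)
    (c : Gelt R a b) : set (amb R l a b) :=
  [set p : amb R l a b | [/\ torusT p,
     (forall j : 'I_a,
        \prod_(i < l) (Complex (p.1.1 i j) (p.1.2 i j)) ^ (alpha i)
        = Complex (c.1.1 j) (c.1.2 j)) &
     (forall k : 'I_b, \sum_(i < l) (alpha i)%:~R * p.2 i k = c.2 k)]].

Definition is_comp (T : topologicalType) (S C : set T) :=
  exists x, S x /\ C = connected_component S x.

Definition hdata (R : realType) (l a b : nat) :=
  (('I_l -> int) * Gelt R a b)%type.

Definition valid_data (R : realType) (l a b n : nat)
    (dat : 'I_n -> hdata R l a b) :=
  forall k, (exists i, (dat k).1 i != 0) /\ in_G (dat k).2.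

Definition arrangement (R : realType) (l a b n : nat)
    (dat : 'I_n -> hdata R l a b) : set (set (amb R l a b)) :=
  [set C | exists k : 'I_n, is_comp (Hset (dat k).1 (dat k).2) C].

Definition rle (E : Type) (X Y : set E) : Prop := Y `<=` X.

(* L(B): connected components of nonempty intersections of subsets of B
   (the empty intersection being T) *)
Definition Lat (R : realType) (l a b : nat) (B : set (set (amb R l a b))) :
    set (set (amb R l a b)) :=
  [set X | exists F : set (set (amb R l a b)),
     F `<=` B /\ is_comp (@torusT R l a b `&` \bigcap_(H in F) H) X].

Definition arr_Mideal (strict : bool) (R : realType) (l a b : nat)
    (A B : set (set (amb R l a b))) :=
  [/\ B `<=` A,
      order_ideal (@rle _) (Lat A) (Lat B),
      Lat B <> Lat A,
      (forall H1 H2, A H1 -> ~ B H1 -> A H2 -> ~ B H2 -> H1 <> H2 ->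
         forall C, is_comp (H1 `&` H2) C -> exists H3, B H3 /\ C `<=` H3) &
      (strict -> forall X H, Lat B X -> A H -> ~ B H -> connected (X `&` H))].

(* Main.v *)
Require Import Defs.
From HB Require Import structures.
From mathcomp Require Import all_boot all_order all_algebra.
From mathcomp Require Import all_classical all_reals all_analysis.
From mathcomp Require Import complex.
From mathcomp Require Import ring lra.
Set Implicit Arguments.
Unset Strict Implicit.
Unset Printing Implicit Defensive.
Import Order.TTheory GRing.Theory Num.Theory numFieldTopology.Exports numFieldNormedType.Exports.
Local Open Scope ring_scope.
Local Open Scope classical_set_scope.

(** T = G^l is a homogeneous space for translations by real vectors, so near a
    point p everything is linear: the component at p of an intersection of sets
    H_{alpha_k,c_k} is the coset of p under the vectors annihilated by all the
    characters alpha_k, since a translation by a small vector preserves H_{alpha,c}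
    only if alpha kills that vector.  Hence the elements of L(B) containing p
    correspond to the subspaces ("flats") spanned by the characters of the members
    of B through p; in particular rk X is the dimension of its flat, and L(B) is
    locally geometric.

    From posets to arrangements: if Q_0 < ... < Q_r is a chain of M-ideals, then
    Q_i = L(B_i) for B_i the set of hyperplanes in Q_i.  If H1, H2 are not in B_i and
    C is a component of their intersection, let y be a modular element of
    corank 1 below a maximal x >= C.  If y and C had trivial meet, a complement z <= y
    of C in [0,x] would be a proper element below y, and modularity would give
    y = y /\ (C \/ z) = (y /\ C) \/ z = z.

    From arrangements to posets: the exchange property turns the condition on pairs
    into rk L(A_{i+1}) <= rk L(A_i) + 1, so along a chain of length r = rk L(A) each rank
    goes up by exactly one.  Then no character of a member of A_{i+1} \ A_i lies in the
    span of the characters of A_i, which makes the required joins nonempty, and for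
    x maximal in L(A_{i+1}) the join of the members of A_i below x is modular. *)

(** * Translations of the torus *)

Section Circle.
Variable R : realType.
Implicit Types x y c s t u : R.

(** Since the sine of [acos c] is [|s|], the sign of [s] chooses between [acos c] and its opposite.
    The bound by [pi] serves later to read the size of the angle off its cosine. *)
Lemma circle_argument c s : c ^+ 2 + s ^+ 2 = 1 ->
  exists t, [/\ `|t| <= pi, cos t = c & sin t = s].
Proof.
move=> cs1.
have c1 : -1 <= c <= 1.
  rewrite -ler_norml -(@ler_pXn2r _ 2)// ?nnegrE// expr1n real_normK ?num_real//.
  by rewrite -cs1 lerDl sqr_ge0.
have sE : Num.sqrt (1 - c ^+ 2) = `|s| by rewrite -cs1 addrC addKr sqrtr_sqr.
have [s0|s0] := leP 0 s.
  exists (acos c); rewrite acosK// sin_acos// sE ger0_norm ?acos_ge0//.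
  by split; rewrite ?acos_lepi// ger0_norm.
exists (- acos c); rewrite cosN sinN acosK// sin_acos// sE normrN.
rewrite ger0_norm ?acos_ge0//.
by split; rewrite ?acos_lepi// ltr0_norm// opprK.
Qed.

Lemma cos_gt_small t e : 0 <= e <= pi -> `|t| <= pi -> cos e < cos t -> `|t| < e.
Proof.
move=> e0pi tpi; rewrite -(cos_norm t) ltr_cos// in_itv//=.
by rewrite normr_ge0.
Qed.

Lemma cos_eq1_small t : cos t = 1 -> `|t| <= 1 -> t = 0.
Proof.
move=> ct t1; apply/normr0_eq0/(@cos_inj R).
- rewrite in_itv/= normr_ge0/= (le_trans t1)//.
  by rewrite (le_trans _ (pi_ge2 R))// ler1n.
- by rewrite in_itv/= lexx pi_ge0.
- by rewrite cos_norm cos0.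
Qed.

Lemma mul_Complex x y c s :
  Complex x y * Complex c s = Complex (x * c - y * s) (x * s + y * c).
Proof. by []. Qed.

Definition cis t : R[i] := Complex (cos t) (sin t).

Lemma cisD t u : cis (t + u) = cis t * cis u.
Proof.
by rewrite /cis cosD sinD mul_Complex [sin t * cos u + _]addrC.
Qed.

Lemma cis0 : cis 0 = 1.
Proof. by rewrite /cis cos0 sin0. Qed.

Lemma cis_neq0 t : cis t != 0.
Proof.
apply/negP => /eqP t0; have := cisD t (- t); rewrite t0 mul0r subrr cis0.
by move/eqP; rewrite oner_eq0.
Qed.

Lemma cisN t : cis (- t) = (cis t)^-1.
Proof.
apply: (mulfI (cis_neq0 t)); rewrite -cisD subrr cis0 divff//; exact: cis_neq0.
Qed.

Lemma cisMz t (m : int) : cis t ^ m = cis (m%:~R * t).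
Proof.
have cisMn k : cis t ^+ k = cis (k%:R * t).
  elim: k => [|k IHk]; first by rewrite mul0r cis0.
  by rewrite exprS IHk -cisD -{1}(mul1r t) -mulrDl -natr1 addrC.
case: m => k; first by rewrite -exprnP cisMn.
by rewrite NegzE -exprnN cisMn -cisN -mulNr mulrNz.
Qed.

Lemma cis_sum (I : finType) (f : I -> R) : cis (\sum_i f i) = \prod_i cis (f i).
Proof. by apply: (big_morph cis cisD cis0). Qed.

End Circle.

Section Translation.
Variables (R : realType) (l a b : nat).
Local Notation vec := ('M[R]_(l, a) * 'M[R]_(l, b))%type.
Local Notation amb := (amb R l a b).
Implicit Types (v w : vec) (p q : amb) (alpha : 'I_l -> int) (c : Gelt R a b).

(** The Lie algebra acts on the torus through the exponential map: circle coordinates are rotated by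
    the angles [v.1], real ones are shifted by [v.2]. *)
Definition translate v p : amb :=
  (\matrix_(i, j) (p.1.1 i j * cos (v.1 i j) - p.1.2 i j * sin (v.1 i j)),
   \matrix_(i, j) (p.1.1 i j * sin (v.1 i j) + p.1.2 i j * cos (v.1 i j)),
   p.2 + v.2).

Lemma translate0 p : translate 0 p = p.
Proof.
case: p => -[X Y] Z; rewrite /translate/= addr0; congr (_, _, _);
  apply/matrixP => i j; rewrite !mxE cos0 sin0.
- by rewrite mulr1 mulr0 subr0.
- by rewrite mulr0 mulr1 add0r.
Qed.

Lemma translateD v w p : translate (v + w) p = translate v (translate w p).
Proof.
rewrite /translate/=; congr (_, _, _); last by rewrite -addrA [w.2 + _]addrC.
- by apply/matrixP => i j; rewrite !mxE cosD sinD; ring.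
- by apply/matrixP => i j; rewrite !mxE cosD sinD; ring.
Qed.

Lemma torus_translate v p : torusT p -> torusT (translate v p).
Proof.
move=> Tp i j; rewrite !mxE.
transitivity (((p.1.1 i j) ^+ 2 + (p.1.2 i j) ^+ 2) *
  (cos (v.1 i j) ^+ 2 + sin (v.1 i j) ^+ 2)); first by ring.
by rewrite Tp cos2Dsin2 mulr1.
Qed.

(** The angles are arguments of the quotients of [q] by [p]. The last two clauses turn closeness of
    [p] and [q] into smallness of [v]. *)
Lemma torus_transitive p q : torusT p -> torusT q -> exists v,
  [/\ q = translate v p,
      forall i j, `|v.1 i j| <= pi &
      forall i j, cos (v.1 i j) = p.1.1 i j * q.1.1 i j + p.1.2 i j * q.1.2 i j].
Proof.
move=> Tp Tq.
have arg i j : exists t, [/\ `|t| <= pi,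
    cos t = p.1.1 i j * q.1.1 i j + p.1.2 i j * q.1.2 i j &
    sin t = p.1.1 i j * q.1.2 i j - p.1.2 i j * q.1.1 i j].
  apply: circle_argument; rewrite -[RHS](mulr1 1) -{1}(Tp i j) -(Tq i j).
  by ring.
pose f i j := projT1 (cid (arg i j)).
have fP i j := projT2 (cid (arg i j)).
exists (\matrix_(i, j) f i j, q.2 - p.2); split; last 2 first.
- by move=> i j; rewrite mxE; have [] := fP i j.
- by move=> i j; rewrite mxE; have [] := fP i j.
rewrite [LHS]surjective_pairing [q.1 in LHS]surjective_pairing /translate/=.
rewrite subrKC; congr (_, _, _); apply/matrixP => i j; rewrite !mxE;
  have [_ -> ->] := fP i j.
- transitivity (((p.1.1 i j) ^+ 2 + (p.1.2 i j) ^+ 2) * q.1.1 i j); last by ring.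
  by rewrite Tp mul1r.
- transitivity (((p.1.1 i j) ^+ 2 + (p.1.2 i j) ^+ 2) * q.1.2 i j); last by ring.
  by rewrite Tp mul1r.
Qed.

Definition real_row alpha : 'rV[R]_l := \row_i (alpha i)%:~R.

Lemma real_row_eq0 alpha : (real_row alpha == 0) = [forall i, alpha i == 0].
Proof.
apply/eqP/forallP => [/rowP r0 i|a0].
  by have := r0 i; rewrite !mxE => /eqP; rewrite intr_eq0.
by apply/rowP => i; rewrite !mxE (eqP (a0 i)).
Qed.

(** A translation multiplies the circle values of the character by [cis] of its value on [v.1] and
    adds its value on [v.2], so the condition does not depend on [c]. *)
Lemma Hset_translate alpha c v p : Hset alpha c p ->
  Hset alpha c (translate v p) <->
  (forall j, cis ((real_row alpha *m v.1) 0 j) = 1) /\ real_row alpha *m v.2 = 0.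
Proof.
move=> [Tp Hc Hr].
have prodE j : \prod_(i < l) (Complex ((translate v p).1.1 i j)
    ((translate v p).1.2 i j)) ^ (alpha i) =
    Complex (c.1.1 j) (c.1.2 j) * cis ((real_row alpha *m v.1) 0 j).
  rewrite mxE cis_sum -Hc -big_split; apply: eq_bigr => i _ /=.
  rewrite !mxE -cisMz -expfzMl; congr (_ ^ _).
have sumE k : \sum_(i < l) (alpha i)%:~R * (translate v p).2 i k =
    c.2 k + (real_row alpha *m v.2) 0 k.
  rewrite mxE -Hr -big_split; apply: eq_bigr => i _ /=.
  by rewrite !mxE mulrDr.
split=> [[_ Hc' Hr']|[c1 r0]].
  split=> [j|].
    have c0 : Complex (c.1.1 j) (c.1.2 j) != 0.
      rewrite -Hc; apply/prodf_neq0 => i _; rewrite expfz_neq0//.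
      apply/negP => /eqP[x0 y0]; have := Tp i j.
      by rewrite x0 y0 expr0n addr0 => /eqP; rewrite eq_sym oner_eq0.
    by apply: (mulfI c0); rewrite -prodE Hc' mulr1.
  apply/rowP => k; rewrite [RHS]mxE; apply: (addrI (c.2 k)).
  by rewrite -sumE Hr' addr0.
split; first exact: torus_translate.
- by move=> j; rewrite prodE c1 mulr1.
- by move=> k; rewrite sumE r0 mxE addr0.
Qed.

End Translation.

(** * Cosets of annihilators *)

Section Cosets.
Variables (R : realType) (l a b : nat).
Local Notation vec := ('M[R]_(l, a) * 'M[R]_(l, b))%type.
Local Notation amb := (amb R l a b).
Implicit Types (v w : vec) (p q : amb) (alpha : 'I_l -> int) (c : Gelt R a b).

Definition annihilator (m : nat) (U : 'M[R]_(m, l)) : set vec :=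
  [set v | U *m v.1 = 0 /\ U *m v.2 = 0].

Definition coset (m : nat) (p : amb) (U : 'M[R]_(m, l)) : set amb :=
  [set translate v p | v in annihilator U].

Lemma annihilatorD m (U : 'M[R]_(m, l)) v w :
  annihilator U v -> annihilator U w -> annihilator U (v + w).
Proof.
by move=> [v1 v2] [w1 w2]; split; rewrite mulmxDr ?v1 ?v2 ?w1 ?w2 addr0.
Qed.

Lemma annihilatorN m (U : 'M[R]_(m, l)) v :
  annihilator U v -> annihilator U (- v).
Proof. by move=> [v1 v2]; split; rewrite mulmxN ?v1 ?v2 oppr0. Qed.

Lemma annihilatorZ m (U : 'M[R]_(m, l)) v (t : R) :
  annihilator U v -> annihilator U (t *: v.1, t *: v.2).
Proof. by move=> [v1 v2]; split; rewrite -scalemxAr ?v1 ?v2 scaler0. Qed.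

Lemma annihilatorS m m' (U : 'M[R]_(m, l)) (V : 'M[R]_(m', l)) :
  (U <= V)%MS -> annihilator V `<=` annihilator U.
Proof.
by move=> /submxP[D ->] v [v1 v2]; split; rewrite -mulmxA ?v1 ?v2 mulmx0.
Qed.

Lemma coset_refl m p (U : 'M[R]_(m, l)) : coset p U p.
Proof. by exists 0; [split; rewrite mulmx0 | exact: translate0]. Qed.

Lemma coset_torus m p (U : 'M[R]_(m, l)) : torusT p -> coset p U `<=` @torusT R l a b.
Proof. by move=> Tp _ [v _ <-]; exact: torus_translate. Qed.

Lemma cosetS m m' p (U : 'M[R]_(m, l)) (V : 'M[R]_(m', l)) :
  (U <= V)%MS -> coset p V `<=` coset p U.
Proof. by move=> UV _ [v Vv <-]; exists v => //; exact: annihilatorS Vv. Qed.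

Lemma coset_eqmx m m' p (U : 'M[R]_(m, l)) (V : 'M[R]_(m', l)) :
  (U :=: V)%MS -> coset p U = coset p V.
Proof. by move=> UV; apply/seteqP; split; apply: cosetS; rewrite UV. Qed.

Lemma coset_base m p q (U : 'M[R]_(m, l)) : coset p U q -> coset q U = coset p U.
Proof.
move=> [w Uw <-]; apply/seteqP; split => _ [v Uv <-].
  by exists (v + w); [exact: annihilatorD | exact: translateD].
exists (v - w); first exact/annihilatorD/annihilatorN.
by rewrite translateD -(translateD (- w)) addNr translate0.
Qed.

Lemma continuous_mx_entries (T : topologicalType) m k (f : T -> 'M[R]_(m, k)) :
  (forall i j, continuous (fun t => f t i j)) -> continuous f.
Proof.
move=> fc t A [B nB BA]; rewrite nbhs_filterE/=.
have : \forall s \near t, forall ij : 'I_m * 'I_k, B ij.1 ij.2 (f s ij.1 ij.2).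
  by apply: filter_forall => -[i j]; exact: (fc i j t _ (nB i j)).
by apply: filterS => s Bs; apply: BA => i j; exact: (Bs (i, j)).
Qed.

Lemma continuous_translate_line v p :
  continuous (fun t : R => translate (t *: v.1, t *: v.2) p).
Proof.
have ccos i j : continuous (fun t : R => cos (t * v.1 i j)).
  move=> t; apply: continuous_comp; last exact: continuous_cos.
  by apply: cvgM; [exact: cvg_id|exact: cvg_cst].
have csin i j : continuous (fun t : R => sin (t * v.1 i j)).
  move=> t; apply: continuous_comp; last exact: continuous_sin.
  by apply: cvgM; [exact: cvg_id|exact: cvg_cst].
have h1 : continuous (fun t : R => (translate (t *: v.1, t *: v.2) p).1.1).
  apply: continuous_mx_entries => i j.
  under eq_fun do rewrite !mxE.
  move=> t; apply: cvgB; apply: cvgM; (try exact: cvg_cst).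
  - exact: ccos.
  - exact: csin.
have h2 : continuous (fun t : R => (translate (t *: v.1, t *: v.2) p).1.2).
  apply: continuous_mx_entries => i j.
  under eq_fun do rewrite !mxE.
  move=> t; apply: cvgD; apply: cvgM; (try exact: cvg_cst).
  - exact: csin.
  - exact: ccos.
have h3 : continuous (fun t : R => (translate (t *: v.1, t *: v.2) p).2).
  apply: continuous_mx_entries => i j.
  under eq_fun do rewrite !mxE.
  move=> t; apply: cvgD; first exact: cvg_cst.
  by apply: cvgM; [exact: cvg_id|exact: cvg_cst].
move=> t; exact: (cvg_pair (cvg_pair (h1 t) (h2 t)) (h3 t)).
Qed.

(** The coset is a union of images of lines [t *: v], all of which pass through [p]. *)
Lemma coset_connected m p (U : 'M[R]_(m, l)) : connected (coset p U).
Proof.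
pose line v := [set translate (t *: v.1, t *: v.2) p | t in [set: R]].
have -> : coset p U = \bigcup_(v in annihilator U) line v.
  apply/seteqP; split => [_ [v Uv <-]|_ [v Uv [t _ <-]]].
    by exists v => //; exists 1 => //; rewrite !scale1r -surjective_pairing.
  by exists (t *: v.1, t *: v.2) => //; exact: annihilatorZ.
apply: bigcup_connected => [|v Uv].
  by exists p => v _; exists 0 => //; rewrite !scale0r; exact: translate0.
apply: connected_continuous_connected; first exact/connected_intervalP.
exact/continuous_subspaceT/continuous_translate_line.
Qed.

End Cosets.

(** * Connected components of intersections *)

Section Components.
Variables (R : realType) (l a b n : nat) (dat : 'I_n -> hdata R l a b).
Local Notation vec := ('M[R]_(l, a) * 'M[R]_(l, b))%type.
Local Notation amb := (amb R l a b).
Implicit Types (v w : vec) (p q : amb) (K : {set 'I_n}).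

Definition normal (k : 'I_n) : 'rV[R]_l := real_row R (dat k).1.
Local Notation hs k := (Hset (dat k).1 (dat k).2).

Definition span K : 'M[R]_l := (\sum_(k in K) <<normal k>>)%MS.

Definition inter K : set amb := [set p | torusT p /\ forall k, k \in K -> hs k p].

Lemma normal_span K k : k \in K -> (normal k <= span K)%MS.
Proof. by move=> kK; rewrite (sumsmx_sup k)// genmxE. Qed.

Lemma span_subP m K (U : 'M[R]_(m, l)) :
  reflect (forall k, k \in K -> (normal k <= U)%MS) (span K <= U)%MS.
Proof.
apply: (iffP idP) => [KU k /normal_span kK|KU]; first exact: submx_trans KU.
by apply/sumsmx_subP => k /KU; rewrite genmxE.
Qed.

Lemma annihilator_span K v :
  (forall k, k \in K -> annihilator (normal k) v) -> annihilator (span K) v.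
Proof.
move=> Kv.
suff h m (w : 'M[R]_(l, m)) :
    (forall k, k \in K -> normal k *m w = 0) -> span K *m w = 0.
  by split; apply: h => k /Kv[].
move=> Kw; apply/sub_kermxP/span_subP => k kK; exact/sub_kermxP/Kw.
Qed.

Lemma coset_inter K p : inter K p -> coset p (span K) `<=` inter K.
Proof.
move=> [Tp Kp] _ [v Uv <-]; split=> [|k kK]; first exact: torus_translate.
apply/Hset_translate; first exact: Kp.
have [v1 v2] := annihilatorS (normal_span kK) Uv.
by rewrite -/(normal k) v1 v2; split=> // j; rewrite mxE cis0.
Qed.

(* The radius does not depend on the points; this makes cosets relatively clopen. *)
Lemma small_translation K : exists2 e : R, 0 < e & forall p q,
  inter K p -> inter K q -> ball p e q -> coset p (span K) q.
Proof.
(* [M] dominates the sum of absolute values of every [normal k], so angles below [M^-1] give the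
   character an angle of at most 1, where [cos_eq1_small] applies. The summand 1 keeps [M^-1] below
   [pi]. *)
pose M : R := 1 + \sum_k \sum_i `|normal k 0 i|.
have M1 : 1 <= M.
  by rewrite lerDl sumr_ge0// => k _; rewrite sumr_ge0.
have M0 : 0 < M by exact: lt_le_trans M1.
have Mpi : 0 <= M^-1 <= pi.
  rewrite invr_ge0 ltW//= (@le_trans _ _ 1) ?invf_le1//.
  by rewrite (le_trans _ (pi_ge2 R))// ler1n.
(* On the unit circle, 1 minus the cosine of the angle is half the squared distance; coordinate
   differences with squares below [d] thus force an angle below [M^-1]. The minimum with 1 in [e]
   makes squares smaller than absolute values. *)
pose d : R := 1 - cos M^-1.
have d0 : 0 < d.
  rewrite subr_gt0 -(cos0 R) ltr_cos ?invr_gt0// in_itv//= lexx pi_ge0//.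
pose e := Num.min 1 d.
have e0 : 0 < e by rewrite lt_min ltr01 d0.
have sqr_small (x : R) : `|x| < e -> x ^+ 2 < d.
  move=> xe; rewrite -real_normK ?num_real// expr2.
  have := xe; rewrite lt_min => /andP[x1 xd].
  by rewrite (le_lt_trans _ xd)// ler_piMl// ltW.
exists e => // p q [Tp Kp] [Tq Kq] [[[_ Bx] [_ By]] _].
have [v [qE vpi vcos]] := torus_transitive Tp Tq.
exists v => //; apply: annihilator_span => k kK.
have vsmall i j : `|v.1 i j| < M^-1.
  apply: cos_gt_small => //; rewrite vcos.
  have := sqr_small _ (Bx i j); have := sqr_small _ (By i j).
  have := Tp i j; have := Tq i j; rewrite /d.
  set x := p.1.1 i j; set y := p.1.2 i j; set x' := q.1.1 i j; set y' := q.1.2 i j.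
  by move=> Eq Ep Hy Hx; nra.
have [+ v2] := (Hset_translate v (Kp k kK)).1 (eq_ind _ _ (Kq k kK) _ qE).
rewrite -/(normal k) => v1; split=> //; apply/rowP => j.
rewrite [RHS]mxE; apply: cos_eq1_small; first by case: (v1 j).
rewrite mxE (le_trans (ler_norm_sum _ _ _))//.
have Mk : \sum_i `|normal k 0 i| <= M.
  rewrite (le_trans _ (_ : \sum_k \sum_i `|normal k 0 i| <= M))//.
    rewrite (bigD1 k)//= lerDl sumr_ge0// => k' _; exact: sumr_ge0.
  by rewrite lerDr.
rewrite (@le_trans _ _ (\sum_i `|normal k 0 i| * M^-1))//.
  by apply: ler_sum => i _; rewrite normrM ler_wpM2l// ltW.
by rewrite -mulr_suml ler_pdivrMr// mul1r.
Qed.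

(** Cosets of [span K] split [inter K] into connected pieces, which [small_translation] keeps a
    distance [e] apart. *)
Lemma component_inter K p : inter K p ->
  connected_component (inter K) p = coset p (span K).
Proof.
move=> Kp; apply/seteqP; split; last first.
  apply: connected_component_max; [exact: coset_refl|exact: coset_inter|].
  exact: coset_connected.
have [e e0 eP] := small_translation K.
move=> x [C [Cp CK Cc] Cx].
pose near (A : set amb) : set amb := \bigcup_(q in A) (ball q e)°.
have near_open A : open (near A) by apply: bigcup_open => q _; exact: open_interior.
have nearS A : A `<=` near A.
  by move=> q Aq; exists q => //; exact: nbhsx_ballx.
have near_coset A q : C q -> near A q -> A `<=` C ->
    exists2 q', A q' & coset q' (span K) = coset q (span K).
  move=> Cq [q' Aq' /interior_subset qq'] AC; exists q' => //.
  by apply/esym/coset_base/eP => //; apply: CK => //; exact: AC.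
suff CE : C = C `&` coset p (span K) by move: Cx; rewrite CE => -[].
(* [near O] shows that [O] is open in [C], the complement of [near O'] that it is closed; as [O]
   contains [p], connectedness gives all of [C]. *)
pose O := C `&` coset p (span K); pose O' := C `\` coset p (span K).
apply/esym/Cc; first by exists p; split=> //; exact: coset_refl.
  exists (near O) => //; apply/seteqP; split=> [q Oq|q [Cq Oq]].
    by split; [case: Oq|exact: nearS].
  have [q' [_ Oq'] qq'] := near_coset _ _ Cq Oq (@subIsetl _ _ _).
  by split=> //; rewrite -(coset_base Oq') qq'; exact: coset_refl.
exists (~` near O'); first exact: open_closedC.
apply/seteqP; split=> [q [Cq pq]|q [Cq Oq]]; split=> //.
  move=> Oq; have [q' [_ Oq'] qq'] := near_coset _ _ Cq Oq (@subDsetl _ _ _).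
  by apply: Oq'; rewrite -(coset_base pq) -qq'; exact: coset_refl.
by apply: contrapT => pq; apply/Oq/nearS.
Qed.

End Components.

(** * Heights, chains and ideals of posets *)

Section Posets.
Variables (X : Type) (le : X -> X -> Prop).
Implicit Types (P Q : set X) (x y : X).

Lemma height_uniq P m m' :
  height le P m -> height le P m' -> m = m'.
Proof.
move=> [[x [s [Px sP <-]]] hm] [[x' [s' [Px' sP' <-]]] hm'].
by apply/anti_leq; rewrite (hm' _ _ Px sP) (hm _ _ Px' sP').
Qed.

Lemma chain_sub P Q x s :
  P `<=` Q -> is_chain le P x s -> is_chain le Q x s.
Proof.
move=> PQ; elim: s x => //= y s IHs x [Py xy ys].
by split; [exact: PQ| |exact: IHs].
Qed.

Lemma order_ideal_trans P Q Q' :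
  order_ideal le P Q -> order_ideal le Q Q' -> order_ideal le P Q'.
Proof.
move=> [QP Qi] [QQ Qi']; split=> [x /QQ/QP//|x y Qy Px xy].
by apply: (Qi' _ y) => //; apply: (Qi _ y) => //; exact: QQ.
Qed.

Lemma join_closed_trans P Q Q' : Q `<=` P -> Q' `<=` Q ->
  Defs.join_closed le P Q -> Defs.join_closed le Q Q' -> Defs.join_closed le P Q'.
Proof.
move=> QP QQ PQ QQ' T TQ z [[Pz Tz] zmin].
have Qz : Q z by apply: (PQ T) => // t /TQ/QQ.
apply: (QQ' T) => //; split=> // y [Qy Ty]; apply: zmin; split=> //; exact: QP.
Qed.

End Posets.

(** * Layers and their flats *)

Section Arrangement.
Variables (R : realType) (l a b n : nat) (dat : 'I_n -> hdata R l a b).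
Hypotheses (dim_gt0 : (0 < a + b)%N) (dat_valid : valid_data dat).
Local Notation vec := ('M[R]_(l, a) * 'M[R]_(l, b))%type.
Local Notation amb := (amb R l a b).
Local Notation A := (arrangement dat).
Local Notation torus := (@torusT R l a b).
Local Notation hs k := (Hset (dat k).1 (dat k).2).
Local Notation normal := (normal dat).
Local Notation span := (span dat).
Local Notation inter := (inter dat).
Implicit Types (v w : vec) (p q x : amb) (K S : {set 'I_n}) (k : 'I_n).
Implicit Types (B F : set (set amb)) (X Y H : set amb).

Lemma normal_neq0 k : normal k != 0.
Proof.
have [[i ai] _] := dat_valid k.
by rewrite real_row_eq0; apply/forallPn; exists i.
Qed.

Lemma span1 k : (span [set k] :=: normal k)%MS.
Proof. by rewrite /span big_set1; exact: genmxE. Qed.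

Lemma spanS S K : S \subset K -> (span S <= span K)%MS.
Proof. by move=> /fintype.subsetP SK; apply/span_subP => k /SK; exact: normal_span. Qed.

Lemma inter1 k : inter [set k] = hs k.
Proof.
apply/seteqP; split=> [p [_]|p kp]; first by apply; rewrite inE.
by split=> [|k']; [case: kp|rewrite inE => /eqP ->].
Qed.

(** A row outside the row space of [U] is not killed by [cokermx U]; a column of that matrix,
    rescaled, is the vector. *)
Lemma separating_vector m (U : 'M[R]_(m, l)) (r : 'rV[R]_l) :
  ~~ (r <= U)%MS -> exists2 u : 'cV[R]_l, U *m u = 0 & r *m u = 1%:M.
Proof.
rewrite submxE; move: (mulmx_coker U); move: (cokermx U) => C UC rC.
have [j rj] : exists j, (r *m C) 0 j != 0.
  apply/existsP; apply: contraNT rC; rewrite negb_exists => /forallP r0.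
  by apply/eqP/rowP => j; rewrite [RHS]mxE; apply/eqP; have := r0 j; rewrite negbK.
exists (((r *m C) 0 j)^-1 *: col j C); rewrite -scalemxAr colE mulmxA.
  by rewrite UC mul0mx scaler0.
rewrite -colE; apply/rowP => i.
by rewrite ord1 [LHS]mxE [X in _ * X]mxE [RHS]mxE eqxx mulVf.
Qed.

(** If [normal k] is not in [U], some vector killed by [U] has value 1 under [normal k] in every
    coordinate of G. By [dim_gt0] there is such a coordinate, and neither the angle 1 nor the real
    number 1 is trivial. *)
Lemma coset_sub_hs m p k (U : 'M[R]_(m, l)) : hs k p ->
  coset p U `<=` hs k <-> (normal k <= U)%MS.
Proof.
move=> kp; split=> [Uk|kU]; last first.
  rewrite -inter1; apply: subset_trans (cosetS kU) _; rewrite -(coset_eqmx _ (span1 k)).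
  by apply: coset_inter; rewrite inter1.
apply: contrapT => /negP/separating_vector[u Uu ku].
have /Uk : coset p U (translate (u *m const_mx 1, u *m const_mx 1) p).
  by eexists; last reflexivity; split; rewrite mulmxA Uu mul0mx.
move/(Hset_translate _ kp); rewrite -/(normal k) !mulmxA ku !mul1mx => -[c1 /rowP r0].
move: dim_gt0; rewrite addn_gt0 => /orP[a0|b0].
  have := c1 (Ordinal a0); rewrite mxE => -[/cos_eq1_small + _].
  by rewrite normr1 lexx => /(_ isT)/eqP; rewrite oner_eq0.
by have := r0 (Ordinal b0); rewrite !mxE => /eqP; rewrite oner_eq0.
Qed.

(** Moving [p] along [u] stays in its coset and changes the value of [normal k] at will; the amount
    is chosen to match the difference [w] between [p] and [q]. *)
Lemma coset_meet m p q k (U : 'M[R]_(m, l)) : torusT p -> torusT q ->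
  ~~ (normal k <= U)%MS -> exists2 x, coset p U x & coset q (normal k) x.
Proof.
move=> Tp Tq /separating_vector[u Uu ku].
have [w [qE _ _]] := torus_transitive Tp Tq.
pose v : vec := (u *m (normal k *m w.1), u *m (normal k *m w.2)).
exists (translate v p).
  by exists v => //; split; rewrite /= mulmxA Uu mul0mx.
exists (v - w); last by rewrite qE -translateD subrK.
by split; rewrite /= mulmxBr (mulmxA _ u) ku mul1mx subrr.
Qed.

Lemma component_hs k p : hs k p -> connected_component (hs k) p = coset p (normal k).
Proof.
by move=> kp; rewrite -inter1 component_inter ?inter1//; exact/coset_eqmx/span1.
Qed.

(** Near [p] a member of [B] is recorded by an index. The base point matters, since other components
    of the same [Hset] may lie outside [B]. *)
Definition through B p : {set 'I_n} := [set k | `[< hs k p /\ B (coset p (normal k)) >]].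

Lemma throughP B p k :
  reflect (hs k p /\ B (coset p (normal k))) (k \in through B p).
Proof. by rewrite inE; exact: asboolP. Qed.

Lemma inter_through B p : torusT p -> inter (through B p) p.
Proof. by move=> Tp; split=> // k /throughP[]. Qed.

Lemma inter_sub S K p : S \subset K -> inter K p -> inter S p.
Proof. by move=> /fintype.subsetP SK [Tp Kp]; split=> // k /SK/Kp. Qed.

Lemma arrangement_at H p : A H -> H p -> exists2 k, hs k p & H = coset p (normal k).
Proof.
move=> [k [x [kx ->]]] Hp; have kp := connected_component_sub Hp.
by exists k => //; rewrite -component_hs// (same_connected_component Hp).
Qed.

Lemma arrangement_torus H : A H -> H `<=` torus.
Proof. by move=> [k [x [_ ->]]] p /connected_component_sub[]. Qed.

Lemma arrangement_neq0 H : A H -> exists p, H p.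
Proof. by move=> [k [x [kx ->]]]; exists x; exact: connected_component_refl. Qed.

Lemma sub_arrangement_at B H p : B `<=` A -> B H -> H p ->
  exists2 k, k \in through B p & H = coset p (normal k).
Proof.
move=> BA BH Hp; have [k kp HE] := arrangement_at (BA _ BH) Hp.
by exists k => //; apply/throughP; rewrite -HE.
Qed.

(** The family [F] is replaced by the finite index set [through F p]. The intersection of [F] lies
    in the corresponding [inter], whose component at [p] is a coset that in turn lies in every
    member of [F]. *)
Lemma component_bigcap F p : F `<=` A -> (torus `&` \bigcap_(H in F) H) p ->
  connected_component (torus `&` \bigcap_(H in F) H) p = coset p (span (through F p)).
Proof.
move=> FA Fp; have [Tp HFp] := Fp; have Ip := inter_through F Tp.
apply/seteqP; split.
  rewrite -component_inter// => q [C [Cp CF Cc] Cq]; exists C => //; split=> //.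
  move=> x /CF[Tx Fx]; split=> // k /throughP[kp Fk].
  have := Fx _ Fk; rewrite -component_hs//; exact: connected_component_sub.
apply: connected_component_max; [exact: coset_refl| |exact: coset_connected].
move=> x px; split; first exact: coset_torus px.
move=> H FH; have [k kF ->] := sub_arrangement_at FA FH (HFp _ FH).
by apply: cosetS px; exact: normal_span.
Qed.

Lemma Lat_coset B S p : B `<=` A -> torusT p -> S \subset through B p ->
  Lat B (coset p (span S)).
Proof.
move=> BA Tp /fintype.subsetP SB.
pose F := [set coset p (normal k) | k in [set k | k \in S]].
have FB : F `<=` B by move=> _ [k /SB/throughP[_ Bk] <-].
have Fp : (torus `&` \bigcap_(H in F) H) p.
  by split=> // _ [k _ <-]; exact: coset_refl.
exists F; split=> //; exists p; split=> //.
rewrite component_bigcap//; last exact: subset_trans FB BA.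
apply/coset_eqmx/eqmxP/andP; split; apply/span_subP => k.
  move=> kS; apply: normal_span; apply/throughP; split; last by exists k.
  by have /throughP[] := SB _ kS.
(* The index [k] may be outside [S], but it has the same component at [p] as some [k'] in [S]. *)
move=> /throughP[kp [k' k'S k'E]]; apply: submx_trans (normal_span _ k'S).
apply/(coset_sub_hs _ kp); rewrite k'E -component_hs//.
exact: connected_component_sub.
Qed.

(** Converse of [Lat_coset], with any point of the layer as base point. *)
Lemma Lat_at B X p : B `<=` A -> Lat B X -> X p ->
  torusT p /\ exists2 S : {set 'I_n}, S \subset through B p & X = coset p (span S).
Proof.
move=> BA [F [FB [x [Fx XE]]]]; rewrite XE => Xp.
have Fp := connected_component_sub Xp; split; first exact: Fp.1.
have FA := subset_trans FB BA.
exists (through F p); last by rewrite -component_bigcap// (same_connected_component Xp).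
by apply/fintype.subsetP => k /throughP[kp Fk]; apply/throughP; split=> //; exact: FB.
Qed.

Lemma Lat_neq0 B X : Lat B X -> exists p, X p.
Proof. by move=> [F [_ [x [Fx ->]]]]; exists x; exact: connected_component_refl. Qed.

Lemma Lat_torus B X : Lat B X -> X `<=` torus.
Proof. by move=> [F [_ [x [Fx ->]]]] p /connected_component_sub[]. Qed.

Lemma Lat_connected B X : Lat B X -> connected X.
Proof. by move=> [F [_ [x [Fx ->]]]]; exact: component_connected. Qed.

Lemma Lat_sub B F : B `<=` F -> Lat B `<=` Lat F.
Proof. by move=> BF X [G [GB GX]]; exists G; split=> //; exact: subset_trans BF. Qed.

(* For a layer X this is the span of the characters constant on X, i.e. the
   conormal space of X. *)
Definition flat X : 'M[R]_l := span [set k | `[< X `<=` hs k >]].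

Lemma flatS X Y : X `<=` Y -> (flat Y <= flat X)%MS.
Proof.
move=> XY; apply: spanS; apply/fintype.subsetP => k; rewrite !inE => Yk.
exact: subset_trans XY Yk.
Qed.

Lemma flat_coset p S : inter S p -> (flat (coset p (span S)) :=: span S)%MS.
Proof.
move=> Sp; apply/eqmxP/andP; split; apply/span_subP => k.
  rewrite inE => /asboolP Sk.
  by apply/coset_sub_hs; [apply: Sk; exact: coset_refl|].
move=> kS; apply: normal_span; rewrite !inE => q.
by move=> /(coset_inter Sp)[_]; exact.
Qed.

Lemma Lat_flat B X p : B `<=` A -> Lat B X -> X p -> X = coset p (flat X).
Proof.
move=> BA BX Xp; have [Tp [S SB XE]] := Lat_at BA BX Xp.
have SX : (flat X :=: span S)%MS.
  by rewrite XE; exact: (flat_coset (inter_sub SB (inter_through B Tp))).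
by rewrite (coset_eqmx p SX).
Qed.

(** [flat] uses all [n] indices, but for a layer of [B] the members of [B] through one point already
    generate it; inclusions of flats can then be tested on these. *)
Lemma Lat_flat_span B X p : B `<=` A -> Lat B X -> X p ->
  (flat X :=: span [set k in through B p | (normal k <= flat X)%MS])%MS.
Proof.
move=> BA BX Xp; have [Tp [S SB XE]] := Lat_at BA BX Xp.
have SX : (flat X :=: span S)%MS.
  by rewrite XE; exact: (flat_coset (inter_sub SB (inter_through B Tp))).
apply/eqmxP/andP; split; last by apply/span_subP => k; rewrite inE => /andP[].
rewrite SX; apply/span_subP => k kS; apply: normal_span; rewrite inE.
by rewrite (fintype.subsetP SB)// SX normal_span.
Qed.

Lemma Lat_subE B F X Y p : B `<=` A -> F `<=` A -> Lat B X -> Lat F Y ->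
  X p -> Y p -> X `<=` Y <-> (flat Y <= flat X)%MS.
Proof.
move=> BA FA BX FY Xp Yp; split; first exact: flatS.
by rewrite {2}(Lat_flat BA BX Xp) {2}(Lat_flat FA FY Yp); exact: cosetS.
Qed.

(** Equal flats alone would allow distinct parallel layers; the inclusion supplies a common
    point. *)
Lemma Lat_flat_inj B F X Y : B `<=` A -> F `<=` A -> Lat B X -> Lat F Y ->
  X `<=` Y -> (flat X <= flat Y)%MS -> X = Y.
Proof.
move=> BA FA BX FY XY XYf; have [p Xp] := Lat_neq0 BX.
by apply/seteqP; split=> //; apply/(Lat_subE FA BA FY BX (XY _ Xp) Xp).
Qed.

Lemma torus_point : exists p, torus p.
Proof.
exists (const_mx 1, const_mx 0, const_mx 0) => i j.
by rewrite !mxE expr1n expr0n addr0.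
Qed.

Lemma torus_coset p : torusT p -> torus = coset p (span finset.set0).
Proof.
move=> Tp; apply/seteqP; split; last exact: coset_torus.
move=> q Tq; have [v [-> _ _]] := torus_transitive Tp Tq.
by exists v => //; apply: annihilator_span => k; rewrite inE.
Qed.

Lemma Lat_top B : B `<=` A -> Lat B torus.
Proof.
move=> BA; have [p Tp] := torus_point.
by rewrite (torus_coset Tp); apply: Lat_coset => //; exact: finset.sub0set.
Qed.

Lemma flat_torus : flat torus = 0.
Proof.
have [p Tp] := torus_point; apply/eqP; rewrite -submx0.
rewrite [X in flat X](torus_coset Tp) flat_coset; last by split=> // k; rewrite inE.
by apply/span_subP => k; rewrite inE.
Qed.

Lemma Lat_atom B H : B `<=` A -> B H -> Lat B H.
Proof.
move=> BA BH; have [p Hp] := arrangement_neq0 (BA _ BH).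
have [k kB ->] := sub_arrangement_at BA BH Hp.
rewrite -(coset_eqmx _ (span1 k)); apply: Lat_coset => //.
  exact: arrangement_torus (BA _ BH) _ Hp.
by rewrite finset.sub1set.
Qed.

Lemma flat_hyperplane p k : hs k p -> (flat (coset p (normal k)) :=: normal k)%MS.
Proof.
move=> kp; rewrite -(coset_eqmx _ (span1 k)).
have kp1 : inter [set k] p by rewrite inter1.
exact: eqmx_trans (flat_coset kp1) (span1 k).
Qed.

Lemma normal_sub_sym k k' : (normal k <= normal k')%MS -> (normal k' <= normal k)%MS.
Proof.
move=> /sub_rVP[c E]; apply/sub_rVP; exists c^-1.
rewrite E scalerA mulVf ?scale1r//.
by apply: contraNneq (normal_neq0 k) => c0; rewrite E c0 scale0r.
Qed.

Lemma arrangement_antichain H H' : A H -> A H' -> H `<=` H' -> H = H'.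
Proof.
move=> AH AH' HH'; have [p Hp] := arrangement_neq0 AH.
apply: (Lat_flat_inj _ _ (Lat_atom _ AH) (Lat_atom _ AH')) => //.
have [k kp HE] := arrangement_at AH Hp.
have [k' kp' HE'] := arrangement_at AH' (HH' _ Hp).
have := flatS HH'; rewrite HE HE' !flat_hyperplane//; exact: normal_sub_sym.
Qed.

Lemma arrangement_neq_torus H : A H -> H <> torus.
Proof.
move=> AH HT; have [p Hp] := arrangement_neq0 AH.
have [k kp HE] := arrangement_at AH Hp.
have : (normal k <= flat H)%MS by rewrite HE flat_hyperplane.
by rewrite HT flat_torus submx0 (negPf (normal_neq0 k)).
Qed.

(** * Rank of layers *)

(** Steinitz exchange: [s] is outside [U], so its coefficient [t] on [r] is invertible. *)
Lemma exchange m (U : 'M[R]_(m, l)) (r s : 'rV[R]_l) :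
  (s <= U + r)%MS -> ~~ (s <= U)%MS -> (r <= U + s)%MS.
Proof.
move=> /sub_addsmxP[[u c] /= sE] sU; move: sE; rewrite (mx11_scalar c) mul_scalar_mx.
set t := c 0 0 => sE; have t0 : t != 0.
  by apply: contraNneq sU => t0; rewrite sE t0 scale0r addr0 submxMl.
have -> : r = t^-1 *: (- (u *m U) + s).
  by rewrite sE addKr scalerA mulVf// scale1r.
apply/scalemx_sub/addmx_sub; last exact: addsmxSr.
by rewrite eqmx_opp (submx_trans (submxMl _ _)) ?addsmxSl.
Qed.

Lemma rank_adds_row m (U : 'M[R]_(m, l)) (r : 'rV[R]_l) :
  (\rank (U + r)%MS <= (\rank U).+1)%N.
Proof.
have [le1 _] := mxrank_adds_leqif U r; apply: leq_trans le1 _.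
by rewrite -[leqRHS]addn1 leq_add2l rank_leq_row.
Qed.

Lemma rank_adds_row_notin m (U : 'M[R]_(m, l)) (r : 'rV[R]_l) :
  ~~ (r <= U)%MS -> \rank (U + r)%MS = (\rank U).+1.
Proof.
move=> rU; apply/anti_leq; rewrite rank_adds_row/=.
rewrite ltn_neqAle mxrankS ?addsmxSl// andbT.
apply: contra rU; rewrite (mxrank_leqif_sup (addsmxSl U r)).
exact: submx_trans (addsmxSr _ _).
Qed.

Lemma Lat_rank_eq B F X Y : B `<=` A -> F `<=` A -> Lat B X -> Lat F Y ->
  X `<=` Y -> (\rank (flat X) <= \rank (flat Y))%N -> X = Y.
Proof.
move=> BA FA BX FY XY rXY; apply: (Lat_flat_inj BA FA BX FY XY).
by rewrite -(mxrank_leqif_sup (flatS XY)) eqn_leq mxrankS ?flatS.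
Qed.

Lemma plt_rank B X Y : B `<=` A -> Lat B X -> Lat B Y ->
  plt (@rle _) X Y -> (\rank (flat X) < \rank (flat Y))%N.
Proof.
move=> BA BX BY [YX XY]; rewrite ltnNge; apply/negP => rXY.
by apply/XY/esym/(Lat_rank_eq BA BA BY BX YX).
Qed.

Lemma chain_rank B X s : B `<=` A -> Lat B X -> is_chain (@rle _) (Lat B) X s ->
  Lat B (last X s) /\ (\rank (flat X) + size s <= \rank (flat (last X s)))%N.
Proof.
move=> BA; elim: s X => [|Y s IHs] X BX /=; first by rewrite addn0.
move=> [BY XY /(IHs _ BY)[sB rB]]; split=> //; apply: leq_trans rB.
by rewrite addnS -addSn leq_add2r; exact: plt_rank BX BY XY.
Qed.

Lemma span_setU S K : (span (S :|: K) :=: span S + span K)%MS.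
Proof.
apply/eqmxP/andP; split; last first.
  by rewrite addsmx_sub !spanS ?finset.subsetUl ?finset.subsetUr.
apply/span_subP => k; rewrite inE => /orP[kS|kK].
  by rewrite (submx_trans (normal_span _ kS)) ?addsmxSl.
by rewrite (submx_trans (normal_span _ kK)) ?addsmxSr.
Qed.

(** Joins, saturated chains and deeper layers are all built by adjoining hyperplanes through a
    common point. *)
Lemma Lat_adjoin B Y p K : B `<=` A -> Lat B Y -> Y p -> K \subset through B p ->
  exists Z, [/\ Lat B Z, Z p, Z `<=` Y & (flat Z :=: flat Y + span K)%MS].
Proof.
move=> BA BY Yp KB; have [Tp [S SB YE]] := Lat_at BA BY Yp.
have SKB : S :|: K \subset through B p by rewrite finset.subUset SB.
have Ip := inter_through B Tp.
exists (coset p (span (S :|: K))); split.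
- exact: Lat_coset.
- exact: coset_refl.
- by rewrite YE; apply/cosetS/spanS/finset.subsetUl.
apply: eqmx_trans (flat_coset (inter_sub SKB Ip)) _.
apply: eqmx_trans (adds_eqmx (eqmx_sym _) (eqmx_refl _)); last first.
  by rewrite YE; exact: flat_coset (inter_sub SB Ip).
exact: span_setU.
Qed.

Lemma Lat_adjoin1 B Y p k : B `<=` A -> Lat B Y -> Y p -> k \in through B p ->
  exists Z, [/\ Lat B Z, Z p, Z `<=` Y & (flat Z :=: flat Y + normal k)%MS].
Proof.
move=> BA BY Yp kB; have kB1 : [set k]%SET \subset through B p by rewrite finset.sub1set.
have [Z [BZ Zp ZY fZ]] := Lat_adjoin BA BY Yp kB1; exists Z; split=> //.
exact: eqmx_trans fZ (adds_eqmx (eqmx_refl _) (span1 k)).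
Qed.

Lemma Lat_flat_subP B X p m (U : 'M[R]_(m, l)) : B `<=` A -> Lat B X -> X p ->
  (forall k, k \in through B p -> (normal k <= flat X)%MS -> (normal k <= U)%MS) ->
  (flat X <= U)%MS.
Proof.
move=> BA BX Xp XU; rewrite (Lat_flat_span BA BX Xp); apply/span_subP => k.
by rewrite inE => /andP[]; exact: XU.
Qed.

Lemma not_sub_normal B X p m (U : 'M[R]_(m, l)) : B `<=` A -> Lat B X -> X p ->
  ~~ (flat X <= U)%MS ->
  exists k, [/\ k \in through B p, (normal k <= flat X)%MS & ~~ (normal k <= U)%MS].
Proof.
move=> BA BX Xp XU; apply: contrapT => noK; move/negP: XU; apply.
apply: (Lat_flat_subP BA BX Xp) => k kB kX; apply: contrapT => /negP kU.
by apply: noK; exists k.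
Qed.

(** Adjoining to [Y] a hyperplane through [X] whose character is not in [flat Y] raises the rank by
    exactly one; the induction is on the difference of ranks. *)
Lemma chain_exists B X Y : B `<=` A -> Lat B X -> Lat B Y -> X `<=` Y ->
  exists s, is_chain (@rle _) (below (@rle _) (Lat B) X) Y s /\
            (size s + \rank (flat Y) = \rank (flat X))%N.
Proof.
move=> BA BX; move dE : (\rank (flat X) - \rank (flat Y))%N => d.
elim: d Y dE => [|d IHd] Y dE BY XY.
  by exists [::]; split=> //; apply/anti_leq; rewrite mxrankS ?flatS// -subn_eq0 dE.
have [p Xp] := Lat_neq0 BX.
have XYn : ~~ (flat X <= flat Y)%MS.
  by apply: contra_eqN dE => /mxrankS; rewrite -subn_eq0 => /eqP ->.
have [k [kB kX kY]] := not_sub_normal BA BX Xp XYn.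
have [Z [BZ Zp ZY fZ]] := Lat_adjoin1 BA BY (XY _ Xp) kB.
have rZ : \rank (flat Z) = (\rank (flat Y)).+1 by rewrite fZ rank_adds_row_notin.
have XZ : X `<=` Z.
  by apply/(Lat_subE BA BA BX BZ Xp Zp); rewrite fZ addsmx_sub flatS.
have [|s [sP sE]] := IHd Z _ BZ XZ; first by rewrite rZ subnS dE.
exists (Z :: s); split; last by rewrite /= addSnnS -rZ.
by split=> //; split=> // YZ; move: rZ; rewrite YZ => /n_Sn.
Qed.

Lemma rank_of_Lat B X : B `<=` A -> Lat B X -> rank_of (@rle _) (Lat B) X (\rank (flat X)).
Proof.
move=> BA BX; split.
  have [s [sP sE]] := chain_exists BA BX (Lat_top BA) (Lat_torus BX).
  exists torus, s; split=> //; first by split; [exact: Lat_top|exact: Lat_torus BX].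
  by rewrite -sE flat_torus mxrank0 addn0.
move=> Y s [BY XY] sP.
have [|sB rB] := chain_rank BA BY (s := s); first by apply: chain_sub sP => ? [].
apply: leq_trans (leq_addl _ _) (leq_trans rB (mxrankS (flatS _))).
by elim: s Y {BY sB rB} XY sP => //= Z s IHs Y XY [[_ XZ] _]; exact: IHs.
Qed.

(** The conormal space common to all maximal layers of [B] ([maximal_normals]); its rank is the
    height of [Lat B] ([height_Lat]). *)
Definition normals B : 'M[R]_l :=
  span [set k | `[< exists2 p, hs k p & B (coset p (normal k)) >]].

Lemma normal_normals B p k : k \in through B p -> (normal k <= normals B)%MS.
Proof.
by move=> /throughP[kp Bk]; apply: normal_span; rewrite !inE; exists p.
Qed.

Lemma normals_subP m B (U : 'M[R]_(m, l)) :
  (forall p k, k \in through B p -> (normal k <= U)%MS) -> (normals B <= U)%MS.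
Proof.
move=> BU; apply/span_subP => k; rewrite !inE => -[p kp Bk].
by apply: (BU p); apply/throughP.
Qed.

Lemma flat_normals B X : B `<=` A -> Lat B X -> (flat X <= normals B)%MS.
Proof.
move=> BA BX; have [p Xp] := Lat_neq0 BX.
by apply: (Lat_flat_subP BA BX Xp) => k kB _; exact: normal_normals kB.
Qed.

Lemma not_normals_sub B m (U : 'M[R]_(m, l)) : ~~ (normals B <= U)%MS ->
  exists p k, k \in through B p /\ ~~ (normal k <= U)%MS.
Proof.
move=> BU; apply: contrapT => noK; move/negP: BU; apply; apply: normals_subP => p k kB.
by apply: contrapT => /negP kU; apply: noK; exists p, k.
Qed.

Lemma through_torus B p k : k \in through B p -> torusT p.
Proof. by move=> /throughP[[]]. Qed.

(** A hyperplane with character outside [flat X] is transverse to [X], so [coset_meet] gives a point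
    of [X] at which it can be adjoined. *)
Lemma Lat_deeper B X : B `<=` A -> Lat B X -> ~~ (normals B <= flat X)%MS ->
  exists Z, [/\ Lat B Z, Z `<=` X & (\rank (flat X) < \rank (flat Z))%N].
Proof.
move=> BA BX /not_normals_sub[q [k [kB kX]]].
have [p Xp] := Lat_neq0 BX.
have [x Xx kx] := coset_meet (Lat_torus BX Xp) (through_torus kB) kX.
rewrite -(Lat_flat BA BX Xp) in Xx.
have kBx : k \in through B x.
  have /throughP[kq Bk] := kB; apply/throughP; rewrite (coset_base kx); split=> //.
  by move: kx; rewrite -component_hs//; exact: connected_component_sub.
have [Z [BZ Zx ZX fZ]] := Lat_adjoin1 BA BX Xx kBx.
by exists Z; split=> //; rewrite fZ rank_adds_row_notin.
Qed.

Lemma maximal_normals B X : B `<=` A -> is_maximal (@rle _) (Lat B) X ->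
  (flat X :=: normals B)%MS.
Proof.
move=> BA [BX Xmax]; apply/eqmxP; rewrite flat_normals//=.
apply: contrapT => /negP/(Lat_deeper BA BX)[Z [BZ ZX rXZ]].
by apply: Xmax; exists Z; split=> //; split=> // XZ; rewrite XZ ltnn in rXZ.
Qed.

Lemma normals_maximal B X : B `<=` A -> Lat B X ->
  (\rank (normals B) <= \rank (flat X))%N -> is_maximal (@rle _) (Lat B) X.
Proof.
move=> BA BX rX; split=> // -[Z [BZ /(plt_rank BA BX BZ)]].
by rewrite ltnNge (leq_trans _ rX)// mxrankS// flat_normals.
Qed.

Lemma maximal_above B Y : B `<=` A -> Lat B Y ->
  exists X, is_maximal (@rle _) (Lat B) X /\ X `<=` Y.
Proof.
move=> BA; move dE : (\rank (normals B) - \rank (flat Y))%N => d.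
elim/ltn_ind: d Y dE => d IHd Y dE BY.
have [rY|rY] := leqP (\rank (normals B)) (\rank (flat Y)).
  by exists Y; split=> //; exact: normals_maximal.
have [|Z [BZ ZY rZ]] := Lat_deeper BA BY.
  by apply: contraL rY => /mxrankS; rewrite -leqNgt.
have [|X [Xmax XZ]] := IHd _ _ Z erefl BZ.
  by rewrite -dE ltn_sub2l.
by exists X; split=> //; exact: subset_trans ZY.
Qed.

Lemma height_Lat B : B `<=` A -> height (@rle _) (Lat B) (\rank (normals B)).
Proof.
move=> BA; have [X [Xmax _]] := maximal_above BA (Lat_top BA); split; last first.
  move=> Y s BY /(chain_rank BA BY)[sB rB].
  apply: leq_trans (leq_addl _ _) (leq_trans rB (mxrankS _)).
  exact: flat_normals.
have [[Y [s [[BY _] sP sE]]] _] := rank_of_Lat BA Xmax.1.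
exists Y, s; split=> //; first by apply: chain_sub sP => ? [].
by rewrite sE (maximal_normals BA Xmax).
Qed.

(** * Local geometry of the poset of layers *)

Lemma sub_hyperplane B X p k : B `<=` A -> Lat B X -> X p -> hs k p ->
  X `<=` coset p (normal k) <-> (normal k <= flat X)%MS.
Proof.
move=> BA BX Xp kp; split=> [/flatS|kX]; first by rewrite flat_hyperplane.
by rewrite (Lat_flat BA BX Xp); exact: cosetS.
Qed.

Lemma Lat_nontop B X p : B `<=` A -> Lat B X -> X p -> X <> torus ->
  exists2 k, k \in through B p & X `<=` coset p (normal k).
Proof.
move=> BA BX Xp XT; have X0 : ~~ (flat X <= (0 : 'M[R]_l))%MS.
  apply/negP; rewrite -flat_torus => X0; apply: XT.
  exact: (Lat_flat_inj BA BA BX (Lat_top BA) (Lat_torus BX)).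
have [k [kB kX _]] := not_sub_normal BA BX Xp X0; exists k => //.
by apply/(sub_hyperplane BA BX Xp) => //; have /throughP[] := kB.
Qed.

Lemma Lat_hyperplane B H : B `<=` A -> A H -> Lat B H -> B H.
Proof.
move=> BA AH BH; have [p Hp] := Lat_neq0 BH.
have [k /throughP[_ Bk] Hk] := Lat_nontop BA BH Hp (arrangement_neq_torus AH).
by rewrite (arrangement_antichain AH (BA _ Bk) Hk).
Qed.

Lemma bottom_Lat B : B `<=` A -> is_bottom (@rle _) (Lat B) torus.
Proof. by move=> BA; split; [exact: Lat_top|move=> X; exact: Lat_torus]. Qed.

Lemma bottom_eq B Z : B `<=` A -> is_bottom (@rle _) (Lat B) Z -> Z = torus.
Proof.
move=> BA [BZ Zmin]; apply/seteqP; split; first exact: Lat_torus BZ.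
exact: Zmin (Lat_top BA).
Qed.

Lemma atoms_Lat B H : B `<=` A -> atoms (@rle _) (Lat B) H <-> B H.
Proof.
move=> BA; split=> [[Z [/(bottom_eq BA) -> [_ BH [_ TH] noZ]]]|BH].
  have [p Hp] := Lat_neq0 BH.
  have [k /throughP[_ Bk] Hk] := Lat_nontop BA BH Hp (nesym TH).
  have [->//|kH] := pselect (H = coset p (normal k)).
  exfalso; apply: noZ; exists (coset p (normal k)); split.
  - exact: Lat_atom.
  - split; first exact: (arrangement_torus (BA _ Bk)).
    exact: nesym (arrangement_neq_torus (BA _ Bk)).
  - by split=> //; exact: nesym.
have LH := Lat_atom BA BH; exists torus; split; first exact: bottom_Lat.
split=> //; first exact: Lat_top.
  split; first exact: Lat_torus LH.
  exact: nesym (arrangement_neq_torus (BA _ BH)).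
move=> [Z [BZ [_ TZ] [HZ ZH]]]; have [p Hp] := Lat_neq0 LH.
have [k /throughP[_ Bk] Zk] := Lat_nontop BA BZ (HZ _ Hp) (nesym TZ).
apply: ZH; apply/seteqP; split=> //.
by rewrite (arrangement_antichain (BA _ BH) (BA _ Bk) (subset_trans HZ Zk)).
Qed.

(** A point of [X] selects one component of the intersection of [Y] and [Z], so joins inside an
    interval are unique and correspond to sums of flats. *)
Lemma Lat_join B X Y Z : B `<=` A -> Lat B X -> Lat B Y -> Lat B Z ->
  X `<=` Y -> X `<=` Z ->
  exists J, [/\ Lat B J, X `<=` J, J `<=` Y, J `<=` Z & (flat J :=: flat Y + flat Z)%MS].
Proof.
move=> BA BX BY BZ XY XZ; have [p Xp] := Lat_neq0 BX.
have KB : [set k in through B p | (normal k <= flat Z)%MS] \subset through B p.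
  by apply/fintype.subsetP => k; rewrite inE => /andP[].
have [J [BJ Jp JY fJ]] := Lat_adjoin BA BY (XY _ Xp) KB.
have {}fJ : (flat J :=: flat Y + flat Z)%MS.
  apply: eqmx_trans fJ (adds_eqmx (eqmx_refl _) (eqmx_sym _)).
  exact: Lat_flat_span BA BZ (XZ _ Xp).
exists J; split=> //.
  by apply/(Lat_subE BA BA BX BJ Xp Jp); rewrite fJ addsmx_sub !flatS.
by apply/(Lat_subE BA BA BJ BZ Jp (XZ _ Xp)); rewrite fJ addsmxSr.
Qed.

Lemma is_lub_below B X Y Z J : B `<=` A -> Lat B X ->
  below (@rle _) (Lat B) X Y -> below (@rle _) (Lat B) X Z ->
  below (@rle _) (Lat B) X J ->
  is_lub (@rle _) (below (@rle _) (Lat B) X) Y Z J <-> (flat J :=: flat Y + flat Z)%MS.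
Proof.
move=> BA BX [BY XY] [BZ XZ] [BJ XJ]; have [p Xp] := Lat_neq0 BX.
split=> [[_ JY JZ Jmin]|fJ]; last first.
  split=> //.
  - by apply/(Lat_subE BA BA BJ BY (XJ _ Xp) (XY _ Xp)); rewrite fJ addsmxSl.
  - by apply/(Lat_subE BA BA BJ BZ (XJ _ Xp) (XZ _ Xp)); rewrite fJ addsmxSr.
  - move=> W [BW XW] WY WZ; apply/(Lat_subE BA BA BW BJ (XW _ Xp) (XJ _ Xp)).
    by rewrite fJ addsmx_sub !flatS.
have [J' [BJ' XJ' JY' JZ' fJ']] := Lat_join BA BX BY BZ XY XZ.
apply/eqmxP/andP; split; last by rewrite addsmx_sub !flatS.
by rewrite -fJ'; apply: flatS; exact: Jmin.
Qed.

(** The intersection of two flats need not be spanned by characters of [B]; the meet is built from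
    those characters that lie in both. *)
Lemma glb_below B X Y Z : B `<=` A -> Lat B X ->
  below (@rle _) (Lat B) X Y -> below (@rle _) (Lat B) X Z ->
  exists M, is_glb (@rle _) (below (@rle _) (Lat B) X) Y Z M.
Proof.
move=> BA BX [BY XY] [BZ XZ]; have [p Xp] := Lat_neq0 BX.
have Tp := Lat_torus BX Xp; have Ip := inter_through B Tp.
pose K := [set k in through B p | (normal k <= flat Y)%MS && (normal k <= flat Z)%MS].
have KB : K \subset through B p.
  by apply/fintype.subsetP => k; rewrite inE => /andP[].
have fM := flat_coset (inter_sub KB Ip); have BM := Lat_coset BA Tp KB.
have Mp : coset p (span K) p by exact: coset_refl.
have lower W : Lat B W -> W p ->
    (forall k, k \in K -> (normal k <= flat W)%MS) -> W `<=` coset p (span K).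
  move=> BW Wp KW; apply/(Lat_subE BA BA BW BM Wp Mp).
  by rewrite fM; exact/span_subP.
exists (coset p (span K)); split.
- split=> //; apply: lower => // k; rewrite inE => /and3P[_ kY _].
  exact: submx_trans kY (flatS XY).
- by apply: lower => //; [exact: XY|move=> k; rewrite inE => /and3P[]].
- by apply: lower => //; [exact: XZ|move=> k; rewrite inE => /and3P[]].
- move=> W [BW XW] YW ZW; apply/(Lat_subE BA BA BM BW Mp (XW _ Xp)); rewrite fM.
  apply: (Lat_flat_subP BA BW (XW _ Xp)) => k kB kW; apply: normal_span.
  by rewrite inE kB !(submx_trans kW)// flatS.
Qed.

Lemma is_glb_normal B X Y Z M p k : B `<=` A -> Lat B X -> X p ->
  below (@rle _) (Lat B) X Y -> below (@rle _) (Lat B) X Z ->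
  is_glb (@rle _) (below (@rle _) (Lat B) X) Y Z M -> k \in through B p ->
  (normal k <= flat Y)%MS -> (normal k <= flat Z)%MS -> (normal k <= flat M)%MS.
Proof.
move=> BA BX Xp [BY XY] [BZ XZ] [_ _ _ Mmax] /throughP[kp Bk] kY kZ.
rewrite -(flat_hyperplane kp).
suff : rle (coset p (normal k)) M by exact: flatS.
apply: Mmax.
- split; first exact: Lat_atom.
  by apply/(sub_hyperplane BA BX Xp kp); exact: submx_trans kY (flatS XY).
- exact/(sub_hyperplane BA BY (XY _ Xp) kp).
- exact/(sub_hyperplane BA BZ (XZ _ Xp) kp).
Qed.

(** If [Z] covers [Y], a hyperplane below [Z] but not below [Y] has a join with [Y] that can only be
    [Z]. Conversely, joining an atom raises the rank by one, which leaves no room in between. *)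
Lemma loc_geometric_Lat B : B `<=` A -> loc_geometric (@rle _) (Lat B).
Proof.
move=> BA X BX; have [p Xp] := Lat_neq0 BX.
have belowT : below (@rle _) (Lat B) X torus by split; [exact: Lat_top|exact: Lat_torus BX].
split.
  split; first by exists torus; split=> // Y [BY _]; exact: Lat_torus BY.
  move=> Y Z XY XZ; split; last exact: glb_below.
  have [J [BJ XJ _ _ fJ]] := Lat_join BA BX XY.1 XZ.1 XY.2 XZ.2.
  by exists J; apply/is_lub_below.
have atom_below k : k \in through B p -> (normal k <= flat X)%MS ->
    atoms (@rle _) (below (@rle _) (Lat B) X) (coset p (normal k)).
  move=> /throughP[kp Bk] kX.
  have [T' [/(bottom_eq BA) -> [_ LH TH noZ]]] := (atoms_Lat (coset p (normal k)) BA).2 Bk.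
  exists torus; split; first by split=> // Y [BY _]; exact: Lat_torus BY.
  split=> //; first by split=> //; apply/(sub_hyperplane BA BX Xp kp).
  by move=> [Z [[BZ _] TZ ZH]]; apply: noZ; exists Z.
move=> Y Z XYb XZb; have [BY XY] := XYb; have [BZ XZ] := XZb.
split=> [[_ _ [ZY YZ] noW]|[H [[T' [[[BT' XT'] Tmin] [_ XHb [HT' T'H] noW]]] HY lubZ]]].
  have ZYn : ~~ (flat Z <= flat Y)%MS.
    by apply/negP => /(Lat_flat_inj BA BA BZ BY ZY)/esym.
  have [k [kB kZ kY]] := not_sub_normal BA BZ (XZ _ Xp) ZYn.
  have [kp Bk] := throughP _ _ _ kB.
  have kX := submx_trans kZ (flatS XZ).
  have Hb : below (@rle _) (Lat B) X (coset p (normal k)).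
    by split; [exact: Lat_atom|exact/(sub_hyperplane BA BX Xp kp)].
  exists (coset p (normal k)); split; first exact: atom_below.
    by move=> /(sub_hyperplane BA BY (XY _ Xp) kp); exact/negP.
  have [J [BJ XJ JY JH fJ]] := Lat_join BA BX BY Hb.1 XY Hb.2.
  have ZJ : Z `<=` J.
    apply/(Lat_subE BA BA BZ BJ (XZ _ Xp) (XJ _ Xp)).
    by rewrite fJ addsmx_sub flatS// flat_hyperplane.
  have -> : Z = J; last exact/is_lub_below.
  apply: contrapT => ZnJ; apply: noW; exists J; split=> //.
    split=> // YJ; move/negP: kY; apply; rewrite YJ fJ.
    by rewrite (submx_trans _ (addsmxSr _ _))// flat_hyperplane.
  by split=> //; exact: nesym.
have TT' : T' = torus.
  by apply/seteqP; split; [exact: Lat_torus BT'|exact: Tmin].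
have [BH XH] := XHb.
have [k kB kH] := Lat_nontop BA BH (XH _ Xp) (nesym (eq_ind _ (fun t => t <> H) T'H _ TT')).
have [kp Bk] := throughP _ _ _ kB.
(* An atom of the interval is a hyperplane; otherwise a member of [B] containing it would lie
   strictly between the bottom and the atom. *)
have HE : H = coset p (normal k).
  apply: contrapT => Hk; apply: noW; exists (coset p (normal k)); split.
  - by split; [exact: Lat_atom|exact: subset_trans XH kH].
  - rewrite TT'; split; first exact: arrangement_torus (BA _ Bk).
    exact: nesym (arrangement_neq_torus (BA _ Bk)).
  - by split=> //; exact: nesym.
have kY : ~~ (normal k <= flat Y)%MS.
  by apply/negP => kY; apply: HY; rewrite HE; apply/(sub_hyperplane BA BY (XY _ Xp) kp).
have fZ := (is_lub_below BA BX XYb XHb XZb).1 lubZ.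
have {}fZ : \rank (flat Z) = (\rank (flat Y)).+1.
  by rewrite fZ HE (adds_eqmx (eqmx_refl _) (flat_hyperplane kp)) rank_adds_row_notin.
have [_ ZY ZH _] := lubZ; split=> //.
  by split=> // YZ; move: fZ; rewrite YZ => /n_Sn.
move=> [W [[BW _] /(plt_rank BA BY BW) YW /(plt_rank BA BW BZ)]].
by rewrite fZ ltnS leqNgt YW.
Qed.

Lemma component_meet B X Y p : B `<=` A -> Lat B X -> Lat B Y -> X p -> Y p ->
  Lat B (connected_component (X `&` Y) p) /\
  (flat (connected_component (X `&` Y) p) :=: flat X + flat Y)%MS.
Proof.
move=> BA BX BY Xp Yp; have [Tp [S SB XE]] := Lat_at BA BX Xp.
have [_ [K KB YE]] := Lat_at BA BY Yp; have Ip := inter_through B Tp.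
have SKB : S :|: K \subset through B p by rewrite finset.subUset SB.
have [Sp Kp] := (inter_sub SB Ip, inter_sub KB Ip).
have -> : connected_component (X `&` Y) p = coset p (span (S :|: K)).
  apply/seteqP; split; last first.
    apply: connected_component_max; [exact: coset_refl| |exact: coset_connected].
    by move=> q Cq; split; rewrite (XE, YE); apply: cosetS Cq; apply: spanS;
      [exact: finset.subsetUl|exact: finset.subsetUr].
  rewrite -component_inter; last exact: inter_sub SKB Ip.
  move=> q [C [Cp CXY Cc] Cq]; exists C => //; split=> // x /CXY[].
  rewrite XE YE => /(coset_inter Sp)[Tx Sx] /(coset_inter Kp)[_ Kx].
  by split=> // k; rewrite inE => /orP[/Sx|/Kx].
split; first exact: Lat_coset.
apply: eqmx_trans (flat_coset (inter_sub SKB Ip)) (eqmx_trans (span_setU _ _) _).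
by rewrite XE YE; apply: adds_eqmx; apply: eqmx_sym; [exact: flat_coset Sp|exact: flat_coset Kp].
Qed.

(** Upper bounds are connected subsets of the intersection, and its components are themselves
    layers; minimal upper bounds are the largest such subsets. *)
Lemma joins_meet B X Y Z : B `<=` A -> Lat B X -> Lat B Y ->
  joins (@rle _) (Lat B) ([set X] `|` [set Y]) Z <-> is_comp (X `&` Y) Z.
Proof.
move=> BA BX BY; split=> [[[BZ XYZ] Zmin]|[p [[Xp Yp] ->]]]; last first.
  have [BC _] := component_meet BA BX BY Xp Yp.
  have CXY := @connected_component_sub _ (X `&` Y) p.
  split; first by split=> // W [->|->] q /CXY[].
  move=> W [BW XYW] CW; apply/seteqP; split=> //.
  apply: connected_component_max; last exact: Lat_connected BW.
    by apply: CW; exact: connected_component_refl.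
  by move=> q Wq; split; apply: (XYW _ _ q Wq); [left|right].
have [p Zp] := Lat_neq0 BZ.
have ZXY : Z `<=` X `&` Y.
  by move=> q Zq; split; apply: (XYZ _ _ q Zq); [left|right].
have [Xp Yp] := ZXY _ Zp; have [BC _] := component_meet BA BX BY Xp Yp.
exists p; split=> //; apply/esym/Zmin.
  by split=> // W [->|->] q /connected_component_sub[].
exact: connected_component_max (Lat_connected BZ).
Qed.

(** * From arrangement M-ideals to poset M-ideals *)

Section PairCover.
Variables A' B : set (set amb).
Hypotheses (AA : A' `<=` A) (BA' : B `<=` A').
Hypothesis cover : forall H1 H2, A' H1 -> ~ B H1 -> A' H2 -> ~ B H2 -> H1 <> H2 ->
  forall C, is_comp (H1 `&` H2) C -> exists H3, B H3 /\ C `<=` H3.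
Let BA := subset_trans BA' AA.

Lemma coset_normal_eq p k k' : hs k p -> hs k' p ->
  (normal k <= normal k')%MS -> coset p (normal k) = coset p (normal k').
Proof.
by move=> kp k'p kk'; apply/coset_eqmx/eqmxP; rewrite kk' normal_sub_sym.
Qed.

Lemma through_coset F p q k : F (coset q (normal k)) -> hs k q ->
  coset q (normal k) p -> k \in through F p.
Proof.
move=> Fk kq qp; apply/throughP; rewrite (coset_base qp); split=> //.
by move: qp; rewrite -component_hs//; exact: connected_component_sub.
Qed.

(** Linear form of the pair condition: the component at [p] has the plane of the two characters as
    flat, and this plane must contain the character of the third hyperplane. *)
Lemma cover_at p k k' : k \in through A' p -> k' \in through A' p ->
  k \notin through B p -> k' \notin through B p -> ~~ (normal k' <= normal k)%MS ->
  exists2 k3, k3 \in through B p & (normal k3 <= normal k + normal k')%MS.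
Proof.
move=> /throughP[kp Ak] /throughP[k'p Ak'] kB k'B kk'.
have nB j : hs j p -> j \notin through B p -> ~ B (coset p (normal j)).
  by move=> jp jB Bj; move/negP: jB; apply; apply/throughP.
have neq : coset p (normal k) <> coset p (normal k').
  move=> E; move/negP: kk'; apply; rewrite -(flat_hyperplane kp) E.
  by rewrite flat_hyperplane.
have kk'p : (coset p (normal k) `&` coset p (normal k')) p.
  by split; exact: coset_refl.
have [|H [BH CH]] := cover Ak (nB _ kp kB) Ak' (nB _ k'p k'B) neq
    (C := connected_component (coset p (normal k) `&` coset p (normal k')) p).
  by exists p.
have Hp : H p by apply: CH; exact: connected_component_refl.
have [k3 k3B HE] := sub_arrangement_at BA BH Hp; exists k3 => //.
have [_ fC] := component_meet AA (Lat_atom AA Ak) (Lat_atom AA Ak') kk'p.1 kk'p.2.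
have := flatS CH; rewrite fC HE flat_hyperplane; last by have /throughP[] := k3B.
by rewrite (adds_eqmx (flat_hyperplane kp) (flat_hyperplane k'p)).
Qed.

(** The third character [j] lies in [U], so it is not proportional to [normal k], and exchange
    expresses [normal k'] through the two. [U] is tested only inside the plane of [k] and [k'] so
    that [flat M2] is admissible in [modular_maximal]. *)
Lemma corank_le1 p m (U : 'M[R]_(m, l)) k k' :
  (forall j, j \in through B p ->
     (normal j <= normal k + normal k')%MS -> (normal j <= U)%MS) ->
  k \in through A' p -> k' \in through A' p ->
  k \notin through B p -> k' \notin through B p ->
  ~~ (normal k <= U)%MS -> (normal k' <= U + normal k)%MS.
Proof.
move=> BU kA k'A kB k'B kU.
have [k'k|k'k] := boolP (normal k' <= normal k)%MS.
  exact: submx_trans k'k (addsmxSr _ _).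
have [j jB jkk'] := cover_at kA k'A kB k'B k'k.
have jU := BU _ jB jkk'.
have jk : ~~ (normal j <= normal k)%MS.
  by apply: contra kU => /normal_sub_sym kj; exact: submx_trans kj jU.
apply: submx_trans (exchange jkk' jk) _.
by rewrite addsmx_sub addsmxSr (submx_trans jU) ?addsmxSl.
Qed.

Lemma notin_through p k m (U : 'M[R]_(m, l)) :
  (forall j, j \in through B p -> (normal j <= U)%MS) ->
  ~~ (normal k <= U)%MS -> k \notin through B p.
Proof. by move=> BU; apply: contra; exact: BU. Qed.

(** Two hyperplanes with characters independent modulo [normals B] would meet by [coset_meet]; at a
    common point [corank_le1] makes them dependent. *)
Lemma rank_normals_le : (\rank (normals A') <= (\rank (normals B)).+1)%N.
Proof.
have [/mxrankS|] := boolP (normals A' <= normals B)%MS; first exact: leqW.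
move=> /not_normals_sub[p [k [kA kB]]].
apply: leq_trans (rank_adds_row _ (normal k)); apply/mxrankS.
apply: contrapT => /negP/not_normals_sub[p' [k' [k'A k'U]]].
have k'k : ~~ (normal k' <= normal k)%MS.
  by apply: contra k'U => h; exact: submx_trans h (addsmxSr _ _).
have [x kx k'x] := coset_meet (through_torus kA) (through_torus k'A) k'k.
have [kp Ak] := throughP _ _ _ kA; have [k'p' Ak'] := throughP _ _ _ k'A.
have BN j : j \in through B x -> (normal j <= normals B)%MS by exact: normal_normals.
move/negP: (k'U); apply; apply: (@corank_le1 x) => //.
- by move=> j /BN.
- exact: through_coset kx.
- exact: through_coset k'x.
- exact: notin_through BN kB.
- apply: notin_through BN _; apply/negP => h; move/negP: k'U; apply.
  exact: submx_trans h (addsmxSl _ _).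
Qed.

Hypothesis corank1 : (\rank (normals B) < \rank (normals A'))%N.

(** Some [k'] has a character outside [normals B]. Where the two hyperplanes meet, a member [j] of
    [B] has its character in their plane: if it is proportional to [normal k], the hyperplane of [k]
    is in [B]; otherwise exchange puts [normal k'] in [normals B]. *)
Lemma notin_normals p k : k \in through A' p -> k \notin through B p ->
  ~~ (normal k <= normals B)%MS.
Proof.
move=> kA kB; apply/negP => kN.
have [|p' [k' [k'A k'N]]] := @not_normals_sub A' _ (normals B).
  by apply: contraL corank1 => /mxrankS; rewrite -leqNgt.
have k'k : ~~ (normal k' <= normal k)%MS.
  by apply: contra k'N => h; exact: submx_trans h kN.
have [x kx k'x] := coset_meet (through_torus kA) (through_torus k'A) k'k.
have [kp Ak] := throughP _ _ _ kA; have [k'p' Ak'] := throughP _ _ _ k'A.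
have kxB : k \notin through B x.
  apply: contra kB => /throughP[_ Bk]; apply/throughP; split=> //.
  by rewrite -(coset_base kx).
have BN j : j \in through B x -> (normal j <= normals B)%MS by exact: normal_normals.
have [j jB jkk'] := cover_at (through_coset Ak kp kx) (through_coset Ak' k'p' k'x)
  kxB (notin_through BN k'N) k'k.
have [jx Bj] := throughP _ _ _ jB.
have [jk|jk] := boolP (normal j <= normal k)%MS.
  move/negP: kxB; apply; apply/throughP.
  have kx' : hs k x by have /throughP[] := through_coset Ak kp kx.
  by split=> //; rewrite -(coset_normal_eq jx kx' jk).
move/negP: k'N; apply; apply: submx_trans (exchange jkk' jk) _.
by rewrite addsmx_sub kN BN.
Qed.

Lemma meet_nonempty X H : Lat B X -> A' H -> ~ B H -> X `&` H !=set0.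
Proof.
move=> BX A'H BH; have [q Hq] := arrangement_neq0 (AA A'H).
have [k kA HE] := sub_arrangement_at AA A'H Hq.
have kB : k \notin through B q.
  by apply/negP => /throughP[_]; rewrite -HE.
have [p Xp] := Lat_neq0 BX.
have kX : ~~ (normal k <= flat X)%MS.
  by apply: contra (notin_normals kA kB) => h; exact: submx_trans h (flat_normals BA BX).
have [x Xx kx] := coset_meet (Lat_torus BX Xp) (through_torus kA) kX.
by exists x; split; [rewrite (Lat_flat BA BX Xp)|rewrite HE].
Qed.

Lemma modular_maximal X : is_maximal (@rle _) (Lat A') X ->
  exists Y, is_maximal (@rle _) (Lat B) Y /\
            modular_in (@rle _) (below (@rle _) (Lat A') X) Y.
Proof.
move=> Xmax; have A'X := Xmax.1; have [p Xp] := Lat_neq0 A'X.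
have Tp := Lat_torus A'X Xp; have fX := maximal_normals AA Xmax.
have KB : through B p \subset through B p by [].
have fY := flat_coset (inter_through B Tp).
set Y := coset p (span (through B p)) in fY *.
have BY : Lat B Y by exact: Lat_coset.
have A'Y : Lat A' Y by exact: Lat_sub BY.
have Yp : Y p by exact: coset_refl.
have BYf j : j \in through B p -> (normal j <= flat Y)%MS.
  by move=> jB; rewrite fY; exact: normal_span.
have XY : X `<=` Y.
  apply/(Lat_subE AA BA A'X BY Xp Yp); rewrite fY fX; apply/span_subP => k.
  by move=> /throughP[kp /BA' A'k]; apply: (@normal_normals _ p); exact/throughP.
exists Y; split.
  (* By [corank_le1] a single further character completes [flat Y] to [flat X], so [Y] has at least
     the rank of [normals B]. *)
  apply: normals_maximal => //; rewrite -ltnS (leq_trans corank1)// -fX.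
  have [/mxrankS/leqW//|XYf] := boolP (flat X <= flat Y)%MS.
  have [k [kA kX kY]] := not_sub_normal AA A'X Xp XYf.
  apply: leq_trans (rank_adds_row _ (normal k)); apply/mxrankS.
  apply: (Lat_flat_subP AA A'X Xp) => k' k'A _.
  have [k'B|k'B] := boolP (k' \in through B p).
    exact: submx_trans (BYf _ k'B) (addsmxSl _ _).
  by apply: (@corank_le1 p) => //; [move=> j /BYf|exact: notin_through BYf kY].
split=> // Z W J1 M1 M2 J2 XZ YZ XW lubJ1 glbM1 glbM2 lubJ2.
have Yb : below (@rle _) (Lat A') X Y by [].
have [XJ1 WJ1 ZJ1 _] := lubJ1; have [XM1 M1Y M1J1 M1max] := glbM1.
have [XM2 M2Y M2W _] := glbM2; have [XJ2 M2J2 ZJ2 J2min] := lubJ2.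
(* The modular inequality, valid in every lattice; the rest compares flats the other way. *)
have M1J2 : M1 `<=` J2.
  apply: J2min => //; apply: M1max => //.
  exact: subset_trans WJ1 M2W.
apply: (Lat_flat_inj AA AA XM1.1 XJ2.1 M1J2).
have fJ1 := (is_lub_below AA A'X XW XZ XJ1).1 lubJ1.
have fJ2 := (is_lub_below AA A'X XM2 XZ XJ2).1 lubJ2.
have M2f k : k \in through A' p -> (normal k <= flat Y)%MS ->
    (normal k <= flat W)%MS -> (normal k <= flat M2)%MS.
  exact: is_glb_normal AA A'X Xp Yb XW glbM2.
have Wp := XW.2 _ Xp.
have [WY|WY] := boolP (flat W <= flat Y)%MS.
  apply: submx_trans (flatS M1J1) _; rewrite fJ1 fJ2; apply: addsmxS => //.
  apply: (Lat_flat_subP AA XW.1 Wp) => k kA kW.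
  by apply: M2f => //; exact: submx_trans WY.
have [K [KA KW KY]] := not_sub_normal AA XW.1 Wp WY.
(* By [corank_le1], [W] is generated by its meet with [Y] and the single hyperplane [K]. *)
have WM2 : (flat W <= flat M2 + normal K)%MS.
  apply: (Lat_flat_subP AA XW.1 Wp) => k kA kW.
  have [kY|kY] := boolP (normal k <= flat Y)%MS.
    by rewrite (submx_trans _ (addsmxSl _ _))// M2f.
  have KM2 : ~~ (normal K <= flat M2)%MS.
    by apply: contra KY => h; exact: submx_trans h (flatS M2Y).
  apply: (@corank_le1 p) => //; [|exact: notin_through BYf KY|exact: notin_through BYf kY].
  move=> j jB jKk; apply: M2f; [|exact: BYf|].
    by have /throughP[jp /BA' A'j] := jB; exact/throughP.
  by apply: submx_trans jKk _; rewrite addsmx_sub KW.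
have J2Y : (flat J2 <= flat Y)%MS.
  by rewrite fJ2 addsmx_sub (flatS M2Y) (flatS YZ).
apply: (Lat_flat_subP AA XM1.1 (XM1.2 _ Xp)) => k kA kM1.
(* Were [normal k] outside [flat J2], exchange would put [normal K] in the span of [flat J2] and
   [normal k], which lies in [flat Y]. *)
apply: contrapT => /negP kJ2; move/negP: KY; apply.
suff : (normal K <= flat J2 + normal k)%MS.
  move=> h; apply: submx_trans h _; rewrite addsmx_sub J2Y.
  exact: submx_trans kM1 (flatS M1Y).
apply: exchange kJ2; apply: submx_trans kM1 (submx_trans (flatS M1J1) _).
have ZJ2f : (flat Z <= flat J2 + normal K)%MS.
  by apply: submx_trans (addsmxSl _ _); exact: flatS.
have M2J2f : (flat M2 <= flat J2 + normal K)%MS.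
  by apply: submx_trans (addsmxSl _ _); exact: flatS.
rewrite fJ1 addsmx_sub ZJ2f andbT (submx_trans WM2)//.
by rewrite addsmx_sub M2J2f addsmxSr.
Qed.

End PairCover.

(** The layer cut out by the members of [B] below [Z] contains [Z] and is still an upper bound of
    [T], so minimality identifies the two. *)
Lemma join_closed_Lat B F : F `<=` A -> B `<=` F -> Defs.join_closed (@rle _) (Lat F) (Lat B).
Proof.
move=> FA BF T TB Z [[FZ TZ] Zmin]; have [p Zp] := Lat_neq0 FZ.
have BA := subset_trans BF FA; have Tp := Lat_torus FZ Zp.
pose K := [set k in through B p | (normal k <= flat Z)%MS].
have KB : K \subset through B p.
  by apply/fintype.subsetP => k; rewrite inE => /andP[].
have fM := flat_coset (inter_sub KB (inter_through B Tp)).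
have BM := Lat_coset BA Tp KB; have Mp : coset p (span K) p by exact: coset_refl.
suff <- : coset p (span K) = Z by [].
apply: Zmin; last first.
  apply/(Lat_subE FA BA FZ BM Zp Mp); rewrite fM.
  by apply/span_subP => k; rewrite inE => /andP[].
split=> [|X TX]; first exact: Lat_sub BM.
have BX := TB _ TX; have ZX : Z `<=` X by exact: TZ.
apply/(Lat_subE BA BA BM BX Mp (ZX _ Zp)); rewrite fM.
apply: (Lat_flat_subP BA BX (ZX _ Zp)) => k kB kX; apply: normal_span.
by rewrite inE kB (submx_trans kX (flatS ZX)).
Qed.

(** Purity holds because ranks in [Lat F] and in [Lat B] are both ranks of flats. In the strict case
    the nonempty connected intersection is its own only component, hence the only join. *)
Lemma poset_Mideal_Lat strict F B : F `<=` A -> arr_Mideal strict F B ->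
  (\rank (normals B) < \rank (normals F))%N ->
  poset_Mideal strict (@rle _) (Lat F) (Lat B).
Proof.
move=> FA [BF ideal _ cover conn] corank1; have BA := subset_trans BF FA.
split=> //; first exact: loc_geometric_Lat.
- split; last exact: join_closed_Lat.
  move=> X Y m m' Xmax Ymax Xm Ym'.
  have rE Z i : is_maximal (@rle _) (Lat B) Z -> rank_of (@rle _) (Lat F) Z i ->
      i = \rank (normals B).
    move=> Zmax Zi; have FZ : Lat F Z by exact: Lat_sub Zmax.1.
    by rewrite (height_uniq Zi (rank_of_Lat FA FZ)) (maximal_normals BA Zmax).
  by rewrite (rE _ _ Xmax Xm) (rE _ _ Ymax Ym').
- move=> X H BX /(atoms_Lat _ FA) FH BnH.
  have BH : ~ B H by move=> BH; apply/BnH/atoms_Lat.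
  have [x [Xx Hx]] := meet_nonempty FA BF cover corank1 BX FH BH.
  have FX := Lat_sub BF BX; have LH := Lat_atom FA FH.
  have joinsE := joins_meet _ FA LH FX.
  case: strict conn => [conn|_]; last first.
    by exists (connected_component (H `&` X) x); apply/joinsE; exists x.
  have HXc : connected (H `&` X) by rewrite setIC; exact: conn.
  exists (H `&` X); apply/seteqP; split=> [Z|_ ->].
    by move/joinsE => [y [HXy ->]]; exact: connected_component_id.
  by apply/joinsE; exists x; rewrite connected_component_id.
- exact: modular_maximal.
Qed.

(** * From poset M-ideals to arrangement M-ideals *)

(** [S] has maximal size among the subsets of [K] with span independent of [U]. It supplies the
    complement in the modularity argument. *)
Lemma independent_extension m (U : 'M[R]_(m, l)) K : exists S : {set 'I_n},
  [/\ S \subset K, (span K <= U + span S)%MS &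
      (\rank U + \rank (span S) <= \rank (U + span S)%MS)%N].
Proof.
pose P (S : {set 'I_n}) := (S \subset K) &&
  (\rank U + \rank (span S) <= \rank (U + span S)%MS)%N.
have P0 : P finset.set0.
  rewrite /P finset.sub0set/= {1}/span finset.big_set0 mxrank0 addn0.
  by rewrite mxrankS ?addsmxSl.
case: (@arg_maxnP _ finset.set0 P (fun S => #|S|) P0) => S /andP[SK rS] Smax.
exists S; split=> //; apply/span_subP => k kK; apply: contrapT => /negP kS.
have kNS : k \notin S.
  by apply: contra kS => kS'; exact: submx_trans (normal_span _ kS') (addsmxSr _ _).
have /Smax : P (k |: S); last by rewrite cardsU1 kNS/= add1n ltnn.
rewrite /P finset.subUset finset.sub1set kK SK/=.
have rkS : (\rank (span (k |: S)) <= (\rank (span S)).+1)%N.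
  apply: leq_trans (rank_adds_row _ (normal k)); apply: mxrankS.
  by rewrite span_setU addsmxC addsmxS// span1.
have rUkS : ((\rank (U + span S)%MS).+1 <= \rank (U + span (k |: S))%MS)%N.
  rewrite -(rank_adds_row_notin kS); apply: mxrankS; rewrite addsmx_sub; apply/andP; split.
    by apply: addsmxS => //; apply: spanS; exact: finset.subsetUr.
  by apply: submx_trans (addsmxSr _ _); apply: normal_span; exact: finset.setU11.
apply: leq_trans rUkS; apply: (@leq_trans (\rank U + (\rank (span S)).+1)%N).
  by rewrite leq_add2l.
by rewrite addnS ltnS.
Qed.

Lemma arr_Mideal_Lat strict F B : F `<=` A -> B `<=` F -> Lat B <> Lat F ->
  (\rank (normals F) <= (\rank (normals B)).+1)%N ->
  poset_Mideal strict (@rle _) (Lat F) (Lat B) -> arr_Mideal strict F B.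
Proof.
move=> FA BF BFn rF [_ ideal _ joinP modP]; have BA := subset_trans BF FA.
split=> //; last first.
  move=> st X H BX FH BnH; rewrite st in joinP.
  have FX := Lat_sub BF BX; have LH := Lat_atom FA FH.
  have [||z zE] := joinP X H BX.
  - exact/atoms_Lat.
  - by move=> /(atoms_Lat _ BA).
  (* Every component is a join, hence equals [z], so the whole intersection is [z]. *)
  have zP p : (H `&` X) p -> connected_component (H `&` X) p = z.
    move=> HXp; have : joins (@rle _) (Lat F) ([set H] `|` [set X])
      (connected_component (H `&` X) p) by apply/joins_meet => //; exists p.
    by rewrite zE.
  have /joins_meet[//|//|//|p [HXp zp]] :
    joins (@rle _) (Lat F) ([set H] `|` [set X]) z by rewrite zE.
  rewrite setIC; have <- : z = H `&` X; last by rewrite zp; exact: component_connected.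
  apply/seteqP; split=> [q|q HXq]; first by rewrite zp => /connected_component_sub.
  by rewrite -(zP q HXq); exact: connected_component_refl.
move=> H1 H2 FH1 BH1 FH2 BH2 H12 C [p [[H1p H2p] CE]]; apply: contrapT => noH3.
have [FC fC] := component_meet FA (Lat_atom FA FH1) (Lat_atom FA FH2) H1p H2p.
rewrite -CE in FC fC; have C12 : C `<=` H1 `&` H2.
  by rewrite CE; exact: connected_component_sub.
have [X [Xmax XC]] := maximal_above FA FC; have FX := Xmax.1.
have [q Xq] := Lat_neq0 FX; have Cq := XC _ Xq; have [H1q H2q] := C12 _ Cq.
have [k1 k1F H1E] := sub_arrangement_at FA FH1 H1q.
have [k2 k2F H2E] := sub_arrangement_at FA FH2 H2q.
have [k1q _] := throughP _ _ _ k1F; have [k2q _] := throughP _ _ _ k2F.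
have k1C : (normal k1 <= flat C)%MS.
  by apply/(sub_hyperplane FA FC Cq k1q); rewrite -H1E => x /C12[].
have rC : (1 < \rank (flat C))%N.
  have k21 : ~~ (normal k2 <= normal k1)%MS.
    apply/negP => k21; apply: H12; rewrite H1E H2E.
    exact/esym/coset_normal_eq.
  have <- : \rank (normal k1 + normal k2)%MS = 2%N.
    by rewrite rank_adds_row_notin// rank_rV normal_neq0.
  rewrite mxrankS// addsmx_sub k1C.
  by apply/(sub_hyperplane FA FC Cq k2q); rewrite -H2E => x /C12[].
have [Y [Ymax [Yb modY]]] := modP X Xmax; have [FY XY] := Yb; have BY := Ymax.1.
have Yq := XY _ Xq; have fY := maximal_normals BA Ymax.
have inB k : k \in through F q -> (normal k <= flat Y)%MS -> k \in through B q.
  move=> /throughP[kq Fk] kY; apply/throughP; split=> //.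
  apply: Lat_hyperplane => //; first exact: FA.
  apply: (ideal.2 _ Y) => //; first exact: Lat_atom.
  exact/(sub_hyperplane BA BY Yq kq).
have k1Y : ~~ (normal k1 <= flat Y)%MS.
  by apply/negP => /(inB _ k1F)/throughP[_]; rewrite -H1E.
(* A hyperplane below both [Y] and [C] would be a member of [B] containing [C]; hence [Y] and [C]
   have trivial meet. *)
have noK k : k \in through F q -> (normal k <= flat Y)%MS -> ~~ (normal k <= flat C)%MS.
  move=> kF kY; apply/negP => kC; have /throughP[kq Bk] := inB _ kF kY.
  apply: noH3; exists (coset q (normal k)); split=> //.
  exact/(sub_hyperplane FA FC Cq kq).
have [S [SK KS rS]] := independent_extension (flat C)
  [set k in through B q | (normal k <= flat Y)%MS].
have SB : S \subset through B q.
  by apply: fintype.subset_trans SK _; apply/fintype.subsetP => k; rewrite inE => /andP[].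
have Tq := Lat_torus FX Xq.
have fZ := flat_coset (inter_sub SB (inter_through B Tq)).
have BZ := Lat_coset BA Tq SB; have Zq : coset q (span S) q by exact: coset_refl.
set Z := coset q (span S) in fZ BZ Zq.
have YZ : Y `<=` Z.
  apply/(Lat_subE BA BA BY BZ Yq Zq); rewrite fZ; apply/span_subP => k.
  by move=> /(fintype.subsetP SK); rewrite inE => /andP[].
have FZ := Lat_sub BF BZ; have XZ := subset_trans XY YZ.
have Xb : below (@rle _) (Lat F) X X by split=> // x.
have Zb : below (@rle _) (Lat F) X Z by [].
have Cb : below (@rle _) (Lat F) X C by [].
have Tb : below (@rle _) (Lat F) X torus.
  by split; [exact: Lat_top|exact: Lat_torus FX].
have CSX : (flat C + span S <= flat X)%MS.
  by rewrite addsmx_sub (flatS XC) -fZ flatS.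
have YCS : (flat Y <= flat C + span S)%MS.
  by rewrite (Lat_flat_span BA BY Yq).
have rX : (\rank (flat X) <= (\rank (flat Y)).+1)%N.
  by rewrite (maximal_normals FA Xmax) fY.
have rYk1 := rank_adds_row_notin k1Y.
have XYk1 : (flat X <= flat Y + normal k1)%MS.
  have Yk1X : (flat Y + normal k1 <= flat X)%MS.
    by rewrite addsmx_sub (flatS XY) (submx_trans k1C (flatS XC)).
  by rewrite -(mxrank_leqif_sup Yk1X) eqn_leq mxrankS// rYk1.
have : Y = Z.
  (* The join of [C] and [Z] is [X], whose meet with [Y] is [Y]; the meet of [Y] and [C] is the
     torus, whose join with [Z] is [Z]. *)
  apply: (modY Z C X Y torus Z) => //.
  - apply/is_lub_below => //; apply/eqmxP/andP; split.
      apply: submx_trans XYk1 _; rewrite addsmx_sub; apply/andP; split.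
        by apply: submx_trans YCS _; apply: addsmxS => //; rewrite fZ.
      exact: submx_trans k1C (addsmxSl _ _).
    by rewrite addsmx_sub (flatS XC) flatS.
  - by split=> // x.
  - split=> //; first exact: Lat_torus FY.
      exact: Lat_torus FC.
    move=> W [FW XW] YW CW; have WT : flat W = 0.
      apply/eqP; rewrite -submx0; apply: (Lat_flat_subP FA FW (XW _ Xq)) => k kF kW.
      have := noK k kF (submx_trans kW (flatS YW)).
      by rewrite (submx_trans kW (flatS CW)).
    suff -> : W = torus by [].
    by apply: (Lat_flat_inj FA FA FW Tb.1 (Lat_torus FW)); rewrite WT sub0mx.
  - by split=> //; exact: Lat_torus FZ.
(* Independence adds the ranks of [C] and [Z = Y] inside [X], but [C] has rank at least 2 and [Y]
   has corank at most 1. *)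
move=> YZE; have : (\rank (flat C) + \rank (flat Z) <= \rank (flat X))%N.
  by rewrite fZ (leq_trans rS)// mxrankS.
rewrite -YZE => h; have := leq_trans h rX.
by rewrite -add1n leq_add2r leqNgt rC.
Qed.

(** * Chains of ideals and chains of subarrangements *)

(** The hyperplanes defining a layer of [Q] are below it, so they lie in the ideal; conversely a
    layer is a minimal upper bound of its hyperplanes, so join-closedness recovers it. *)
Lemma Lat_order_ideal (Q : set (set amb)) :
  order_ideal (@rle _) (Lat A) Q -> Defs.join_closed (@rle _) (Lat A) Q ->
  Lat [set H | A H /\ Q H] = Q.
Proof.
move=> [QP Qideal] Qjoin; apply/seteqP; split=> [X BX|X QX]; last first.
  have [F [FA [p [Fp XE]]]] := QP _ QX; exists F; split; last by exists p.
  move=> H FH; split; first exact: FA.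
  apply: (Qideal _ X) => //; first exact: Lat_atom (FA _ FH).
  by move=> x; rewrite XE => /connected_component_sub[_]; exact.
have AX : Lat A X by apply: Lat_sub BX => H [].
have [F [FB [p [Fp XE]]]] := BX.
apply: (Qjoin F) => [H /FB[]//|]; split.
  by split=> // H FH x; rewrite XE => /connected_component_sub[_]; exact.
move=> Z [AZ FZ] XZ; apply/seteqP; split=> //; rewrite XE.
apply: connected_component_max; last exact: Lat_connected AZ.
  by apply: XZ; rewrite XE; exact: connected_component_refl.
by move=> x Zx; split; [exact: Lat_torus AZ _ Zx|move=> H FH; exact: FZ FH _ Zx].
Qed.

Lemma normals0 : normals set0 = 0.
Proof. by apply/eqP; rewrite -submx0; apply: normals_subP => p k /throughP[]. Qed.

Lemma Lat0 : Lat set0 = [set torus].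
Proof.
apply/seteqP; split=> [X LX|_ ->]; last exact: Lat_top.
apply: (Lat_flat_inj _ _ LX (Lat_top (B := set0) _) (Lat_torus LX)) => //.
by rewrite flat_torus -normals0; exact: flat_normals LX.
Qed.

(** Both ideal properties pass down from [Q r], so [Q j] is [Lat (B j)], and its height [j] is the
    rank of [normals (B j)]. *)
Lemma chain_of_ideals strict (Q : nat -> set (set amb)) r :
  Q r = Lat A ->
  (forall i, (i < r)%N ->
     [/\ Q i `<=` Q i.+1, Q i <> Q i.+1 & poset_Mideal strict (@rle _) (Q i.+1) (Q i)]) ->
  (forall i, (i <= r)%N -> height (@rle _) (Q i) i) ->
  forall i, (i < r)%N ->
    let B j := [set H | A H /\ Q j H] in
    B i `<=` B i.+1 /\ arr_Mideal strict (B i.+1) (B i).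
Proof.
move=> Qr Qstep Qh.
have QA i : (i <= r)%N ->
    order_ideal (@rle _) (Lat A) (Q i) /\ Defs.join_closed (@rle _) (Lat A) (Q i).
  move=> ir; rewrite -(subKn ir); elim: (r - i)%N (leq_subr i r) => [|d IHd] dr.
    rewrite subn0 Qr; split; first by split.
    by move=> T _ Z [[]].
  have [ideal jc] := IHd (ltnW dr).
  have rd : (r - d.+1).+1 = (r - d)%N by rewrite subnSK.
  have [|QQ _ [_ ideal' [_ jc'] _ _]] := Qstep (r - d.+1)%N.
    by rewrite ltn_subrL (leq_ltn_trans (leq0n d) dr).
  rewrite rd in QQ ideal' jc'; split; first exact: order_ideal_trans ideal ideal'.
  by apply: join_closed_trans jc jc' => //; exact: ideal.1.
move=> i ir B; have BA j : B j `<=` A by move=> H [].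
have LB j : (j <= r)%N -> Lat (B j) = Q j.
  by move=> /QA[]; exact: Lat_order_ideal.
have rB j : (j <= r)%N -> \rank (normals (B j)) = j.
  move=> jr; apply: (@height_uniq _ (@rle _) (Lat (B j))); first exact: height_Lat.
  by rewrite LB//; exact: Qh.
have [QQ Qn QM] := Qstep i ir.
have BB : B i `<=` B i.+1 by move=> H [AH QH]; split=> //; exact: QQ.
split=> //; apply: arr_Mideal_Lat => //.
- by rewrite !LB// ltnW.
- by rewrite !rB// ltnW.
- by rewrite !LB// ltnW.
Qed.

Lemma chain_of_subarrangements strict (B : nat -> set (set amb)) r :
  height (@rle _) (Lat A) r -> B 0%N = set0 -> B r = A ->
  (forall i, (i < r)%N -> B i `<=` B i.+1 /\ arr_Mideal strict (B i.+1) (B i)) ->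
  poset_supersolvable strict (@rle _) (Lat A).
Proof.
move=> Ah B0 Br Bstep.
have BA i : (i <= r)%N -> B i `<=` A.
  move=> ir; rewrite -(subKn ir); elim: (r - i)%N (leq_subr i r) => [|d IHd] dr.
    by rewrite subn0 Br.
  have [|BB _] := Bstep (r - d.+1)%N.
    by rewrite ltn_subrL (leq_ltn_trans (leq0n d) dr).
  rewrite subnSK// in BB; exact: subset_trans BB (IHd (ltnW dr)).
have rstep i : (i < r)%N -> (\rank (normals (B i.+1)) <= (\rank (normals (B i))).+1)%N.
  move=> ir; have [BB [_ _ _ cover _]] := Bstep i ir.
  exact: rank_normals_le (BA _ ir) BB cover.
(* Steps raise the rank by at most one: counting up from [B 0] bounds the ranks above, counting down
   from [B r] bounds them below. *)
have rup i : (i <= r)%N -> (\rank (normals (B i)) <= i)%N.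
  elim: i => [|i IHi] ir; first by rewrite B0 normals0 mxrank0.
  by rewrite (leq_trans (rstep i ir))// ltnS IHi// ltnW.
have rdown d : (d <= r)%N -> (r <= \rank (normals (B (r - d)%N)) + d)%N.
  elim: d => [|d IHd] dr.
    by rewrite subn0 addn0 Br (height_uniq Ah (height_Lat (fun _ => id))).
  apply: leq_trans (IHd (ltnW dr)) _; rewrite addnS -addSn leq_add2r -subnSK//.
  by apply: rstep; rewrite ltn_subrL (leq_ltn_trans (leq0n d) dr).
have rE i : (i <= r)%N -> \rank (normals (B i)) = i.
  move=> ir; apply/anti_leq; rewrite rup//=.
  by have := rdown (r - i)%N (leq_subr _ _); rewrite addnC -leq_subLR !subKn.
exists r, (fun i => Lat (B i)); split.
- exists torus; split; first exact: bottom_Lat.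
  by rewrite B0 Lat0.
- by rewrite Br.
- move=> i ir; have [BB BM] := Bstep i ir; split.
  + exact: Lat_sub.
  + by case: BM.
  + by apply: poset_Mideal_Lat => //; [exact: BA|rewrite !rE// ltnW].
- by move=> i ir; rewrite -[i in height _ _ i]rE//; apply: height_Lat; exact: BA.
Qed.

End Arrangement.

Theorem theorem5p16 (R : realType) (l a b n : nat)
    (dat : 'I_n -> hdata R l a b) (r : nat) :
  (0 < a + b)%N ->
  valid_data dat ->
  height (@rle _) (Lat (arrangement dat)) r ->
  forall strict : bool,
    poset_supersolvable strict (@rle _) (Lat (arrangement dat)) <->
    exists Ach : nat -> set (set (amb R l a b)),
      [/\ Ach 0%N = set0, Ach r = arrangement dat &
          forall i, (i < r)%N ->
            Ach i `<=` Ach i.+1 /\ arr_Mideal strict (Ach i.+1) (Ach i)].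
Proof.
move=> ab0 valid Ah strict; split=> [|[B [B0 Br Bstep]]]; last first.
  exact: (chain_of_subarrangements ab0 valid Ah B0 Br Bstep).
move=> [r' [Q [[z [zbot Q0]] Qr Qstep Qh]]].
(* Supersolvability leaves the length of the chain free; the height of its last term fixes it. *)
have r'r : r' = r.
  by apply: (height_uniq (Qh r' (leqnn _))); rewrite Qr.
move: Qr Qstep Qh; rewrite r'r => Qr Qstep Qh.
exists (fun j => [set H | arrangement dat H /\ Q j H]); split.
- apply/seteqP; split=> // H [AH]; rewrite Q0 => Hz.
  apply: (arrangement_neq_torus ab0 valid AH).
  by rewrite Hz; exact: (bottom_eq ab0 (@subset_refl _ _) zbot).
- apply/seteqP; split=> [H []//|H AH]; split=> //.
  by rewrite Qr; exact: (Lat_atom ab0 (@subset_refl _ _)).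
- exact: chain_of_ideals.
Qed.
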